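(* Let $\theta\in(0,\pi/2)$ be fixed. Then $$A(d,\theta)\geq (1+o(1))\log\frac{\sin\theta}{\sqrt{2}\sin\frac{\theta}{2}}\cdot d\cdot s_d(\theta)^{-1}, \qquad \text{as } d\to\infty.$$
   Context: Let $\mathbb{S}_{d-1}=\{x\in\mathbb R^d:\|x\|=1\}$. A spherical code of angle $\theta$ in dimension $d$ is a finite set of vectors $x_1,\dots,x_k\in\mathbb{S}_{d-1}$ with $\langle x_i,x_j\rangle\le\cos\theta$ for all $i\neq j$; $A(d,\theta)$ is the maximum size $k$ of such a code. Let $s$ denote the normalised surface measure on $\mathbb{S}_{d-1}$ (so $s(\mathbb{S}_{d-1})=1$), $C_\theta(x)=\{y\in\mathbb{S}_{d-1}:\langle x,y\rangle\ge\cos\theta\}$ the closed spherical cap of angular radius $\theta$, and $s_d(\theta)=s(C_\theta(x))$ (independent of $x$). Logarithms are natural. *)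

(* Defs.v *)
From HB Require Import structures.
From mathcomp Require Export all_boot all_order all_algebra finmap.
From mathcomp Require Export all_classical all_reals all_analysis.

Set Implicit Arguments.
Unset Strict Implicit.
Unset Printing Implicit Defensive.

Import Order.TTheory GRing.Theory Num.Theory.
Import numFieldNormedType.Exports.

Local Open Scope classical_set_scope.
Local Open Scope ring_scope.

(* The library norm `|x| on 'rV[R]_d is the sup norm, hence these two. *)
Definition dotp {R : realType} {d : nat} (x y : 'rV[R]_d) : R :=
  \sum_(i < d) x 0 i * y 0 i.

Definition enorm {R : realType} {d : nat} (x : 'rV[R]_d) : R :=
  Num.sqrt (dotp x x).

Definition sphere (R : realType) (d : nat) : set 'rV[R]_d :=
  [set x | enorm x = 1].
Arguments sphere : clear implicits.

Definition cap {R : realType} {d : nat} (theta : R) (x : 'rV[R]_d) :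
    set 'rV[R]_d :=
  [set y | sphere R d y /\ cos theta <= dotp x y].

Definition spherical_code {R : realType} {d : nat} (theta : R)
    (X : {fset 'rV[R]_d}) : Prop :=
  (forall x, x \in X -> sphere R d x) /\
  (forall x y, x \in X -> y \in X -> x != y -> dotp x y <= cos theta).

(* The default value 0 of xget is used only when code sizes are unbounded,
   which does not happen for 0 < theta. *)
Definition max_code_size {R : realType} (d : nat) (theta : R) : nat :=
  xget 0%N [set k : nat |
    (exists X : {fset 'rV[R]_d}, spherical_code theta X /\ #|` X| = k) /\
    (forall X : {fset 'rV[R]_d}, spherical_code theta X -> (#|` X| <= k)%N)].

(* d-dimensional Lebesgue measure: the d-fold product of lebesgue_measure,
   carried to tuples, then to row vectors. *)
Fixpoint lebesgue_tuple (R : realType) (d : nat) :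
    set (d.-tuple (measurableTypeR R)) -> \bar R :=
  match d with
  | 0 => dirac [tuple]
  | d'.+1 => pushforward
      (product_measure1 (@lebesgue_measure R) (@lebesgue_tuple R d'))
      (fun p : measurableTypeR R * d'.-tuple (measurableTypeR R) =>
         [tuple of p.1 :: p.2])
  end.

Definition lebesgue_rV {R : realType} {d : nat} (A : set 'rV[R]_d) : \bar R :=
  lebesgue_tuple (fun t => A (\row_i tnth t i)).

Definition cone {R : realType} {d : nat} (A : set 'rV[R]_d) : set 'rV[R]_d :=
  [set z | exists r x, [/\ 0 < r, r <= 1, A x & z = r *: x]].

(* Polar-coordinates construction of surface measure: the (unnormalised) area
   of A is d times the volume of the cone over A; the factor d cancels. *)
Definition surface_measure {R : realType} {d : nat} (A : set 'rV[R]_d) : R :=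
  fine (lebesgue_rV (cone A)) / fine (lebesgue_rV (cone (sphere R d))).

(* Main.v *)
From HB Require Import structures.
Require Import Defs.
From mathcomp Require Import ring lra measurable_realfun.

(** Discretise the sphere into cells of tiny diameter, join two cells when
    their representatives are at angle less than [theta], and consider the
    hard-core model with weights [w = lambda * (area of the cell)]; let [I] be
    the random independent set, [Z T] the partition function of a set [T] of
    cells and [alpha T] the mean number of occupied cells of the model on [T].
    Conditioning on [I] outside the cap around a uniform cell [v] leaves the
    model on a random subset [T] of that cap, whence
      [E #|I| = lambda * E (1 / Z T)]  and  [E #|I| * s_d(theta) >= E (alpha T)].
    Always [Z T <= exp (w T)], and [alpha T >= w T - (weight of adjacent pairs
    in T)], so if adjacent pairs are negligible then [w T] is about [alpha T]
    and convexity gives [E #|I| * s_d(theta) >= (1 - o(1)) ln (lambda * s_d(theta))].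

    Put [c = sqrt (cos theta)].  Adjacent pairs are negligible as soon as the
    area of [T] exceeds [(1 - c^2)^(d/2)] by an exponential factor.  Otherwise,
    by convexity, for a large constant [m] a not too small proportion of the
    [m]-tuples of [T] have a large common neighbourhood in [T].  But if the mean
    of the tuple has norm at most [c], this neighbourhood lies in a cap
    [<u, x> >= c], of area about [(1 - c^2)^(d/2)]; and tuples whose mean has
    norm more than [c] are rare by a Chernoff bound.  Hence one may take
    [lambda] nearly [(1 - c^2)^(-d/2)], and
    [ln (lambda * s_d(theta)) / d] tends to
    [ln (sin theta / sqrt (1 - cos theta))]. *)

Set Implicit Arguments.
Unset Strict Implicit.
Unset Printing Implicit Defensive.

Import Order.TTheory GRing.Theory Num.Theory.
Import numFieldNormedType.Exports.

(** * The hard-core model on a finite graph *)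

Section HardCore.
Local Open Scope ring_scope.
Variables (R : realType) (V : finType) (e : rel V).
Hypotheses (e_refl : reflexive e) (e_sym : symmetric e).
Implicit Types (I J K S T : {set V}) (w : V -> R).

Definition indep I := [forall i in I, forall j in I, (i != j) ==> ~~ e i j].

(** As [e] is reflexive, these are closed neighbourhoods; accordingly [indep] tests only distinct
    pairs. *)
Definition nbr v : {set V} := [set j | e v j]%SET.

Definition nbrs J : {set V} := (\bigcup_(j in J) nbr j)%SET.

Definition hcZ w T := \sum_(I | indep I && (I \subset T)) \prod_(i in I) w i.

(** The mean number of occupied vertices is [hcA w T / hcZ w T]; keeping the numerator apart avoids
    division in the identities below. *)
Definition hcA w T :=
  \sum_(I | indep I && (I \subset T)) (\prod_(i in I) w i) * #|I|%:R.

Lemma indepP I :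
  reflect {in I &, forall i j, i != j -> ~~ e i j} (indep I).
Proof.
apply: (iffP idP) => [/forall_inP h i j iI jI ij|h].
  by have /forall_inP/(_ j jI)/implyP/(_ ij) := h _ iI.
by apply/forall_inP => i iI; apply/forall_inP => j jI; apply/implyP => ij; apply: h.
Qed.

Lemma indepS I J : I \subset J -> indep J -> indep I.
Proof. by move=> /fintype.subsetP IJ /indepP h; apply/indepP => i j /IJ ? /IJ ?; apply: h. Qed.

Lemma indep0 : indep finset.set0.
Proof. by apply/indepP => i j; rewrite inE. Qed.

Lemma mem_nbrs J i : (i \in nbrs J) = [exists j in J, e j i].
Proof.
apply/finset.bigcupP/exists_inP => [[j jJ]|[j jJ h]]; first by rewrite inE; exists j.
by exists j => //; rewrite inE.
Qed.

(** Spatial Markov property: given the part [J] of [I] outside [S], the part inside is any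
    independent set of [T :&: S] that avoids the neighbours of [J]. *)
Lemma indep_decomp S T (F : {set V} -> {set V} -> R) :
  \sum_(I | indep I && (I \subset T)) F (I :&: S) (I :\: S) =
  \sum_(J | indep J && (J \subset T :\: S))
    \sum_(K | indep K && (K \subset (T :&: S) :\: nbrs J)) F K J.
Proof.
rewrite (partition_big (fun I => I :\: S)
  (fun J => indep J && (J \subset T :\: S))) /=; last first.
  move=> I /andP[iI IT]; rewrite (indepS _ iI) ?finset.subsetDl//=.
  by rewrite finset.setSD.
apply: eq_bigr => J /andP[iJ JT].
rewrite (reindex_onto (fun K => K :|: J) (fun I => I :&: S)) /=; last first.
  by move=> I /andP[_ /eqP <-]; rewrite finset.setID.
have JdS j : j \in J -> (j \in T) * (j \notin S).
  by move=> /(fintype.subsetP JT); rewrite inE => /andP[-> ->].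
have key K : K \subset S -> ((K :|: J) :\: S == J) && ((K :|: J) :&: S == K).
  move=> KS; apply/andP; split; apply/eqP/finset.setP => x; rewrite !inE.
    case: (boolP (x \in J)) => xJ; first by rewrite orbT JdS.
    case: (boolP (x \in K)) => [/(fintype.subsetP KS) ->//|]; by rewrite andbF.
  case: (boolP (x \in K)) => [/(fintype.subsetP KS) ->//|_] /=.
  by apply/negbTE/negP => /andP[/JdS[_ /negP]].
apply: eq_big => [K|K]; last first.
  by move=> /andP[/andP[_ /eqP ->] /eqP ->].
apply/idP/idP.
  move=> /andP[/andP[/andP[iKJ KJT] /eqP h1] /eqP h2].
  rewrite (indepS _ iKJ) ?finset.subsetUl//=.
  apply/fintype.subsetP => x xK; rewrite !inE.
  have xS : x \in S by move: xK; rewrite -h2 inE => /andP[].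
  have -> : x \in T by apply: (fintype.subsetP KJT); rewrite inE xK.
  rewrite xS !andbT mem_nbrs; apply/negP => /exists_inP[j jJ ejx].
  move/indepP: iKJ => /(_ j x); rewrite !inE jJ xK orbT => /(_ isT isT).
  case: (eqVneq j x) => [jx|_ /(_ isT)]; last by rewrite ejx.
  by have := JdS _ jJ; rewrite jx xS => -[].
move=> /andP[iK KT].
have KS : K \subset S.
  by apply/fintype.subsetP => x /(fintype.subsetP KT); rewrite !inE => /andP[_ /andP[]].
have /andP[-> ->] := key _ KS; rewrite !andbT; apply/andP; split; last first.
  rewrite finset.subUset; apply/andP; split; apply/fintype.subsetP => x.
    by move=> /(fintype.subsetP KT); rewrite !inE => /andP[_ /andP[]].
  by move=> /JdS[].
have cross k j : k \in K -> j \in J -> ~~ e j k.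
  move=> /(fintype.subsetP KT); rewrite !inE => /andP[+ _] jJ; apply: contra => h.
  by rewrite mem_nbrs; apply/exists_inP; exists j.
apply/indepP => i j; rewrite !inE => /orP[iK'|iJ'] /orP[jK'|jJ'] ij.
- by move/indepP: iK; apply.
- by rewrite e_sym; apply: cross.
- exact: cross.
- by move/indepP: iJ; apply.
Qed.

Lemma hcZ_ge0 w T : (forall v, 0 <= w v) -> 0 <= hcZ w T.
Proof. by move=> w0; apply: sumr_ge0 => I _; apply: prodr_ge0. Qed.

Lemma hcA_ge0 w T : (forall v, 0 <= w v) -> 0 <= hcA w T.
Proof.
by move=> w0; apply: sumr_ge0 => I _; apply: mulr_ge0 => //; apply: prodr_ge0.
Qed.

Lemma hcZ_ge1 w T : (forall v, 0 <= w v) -> 1 <= hcZ w T.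
Proof.
move=> w0; rewrite /hcZ (bigD1 finset.set0)/=; last by rewrite indep0 finset.sub0set.
by rewrite finset.big_set0 lerDl; apply: sumr_ge0 => I _; apply: prodr_ge0.
Qed.

Lemma hcZ_mono w S T : (forall v, 0 <= w v) -> S \subset T -> hcZ w S <= hcZ w T.
Proof.
move=> w0 ST; rewrite /hcZ [leRHS](bigID (fun I => I \subset S))/=.
rewrite -[leLHS]addr0; apply: lerD; last by apply: sumr_ge0 => *; apply: prodr_ge0.
rewrite le_eqVlt; apply/orP; left; apply/eqP; apply: eq_bigl => I.
case: (boolP (I \subset S)) => IS; last by rewrite !andbF.
by rewrite (fintype.subset_trans IS ST) !andbT.
Qed.

(** Letting the inner set of [indep_decomp] meet the neighbours of [J] only enlarges the sum. *)
Lemma hcZ_submul w S T : (forall v, 0 <= w v) ->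
  hcZ w T <= hcZ w (T :\: S) * hcZ w (T :&: S).
Proof.
move=> w0; rewrite {1}/hcZ.
under eq_bigr => I _ do rewrite (big_setID S)/=.
rewrite (indep_decomp S T (fun K J => (\prod_(i in K) w i) * \prod_(i in J) w i)).
rewrite {1}/hcZ mulr_suml; apply: ler_sum => J _.
rewrite -mulr_suml mulrC ler_wpM2l//; first exact: prodr_ge0.
by apply: hcZ_mono => //; apply: finset.subsetDl.
Qed.

(** The product of the [1 + w v] expands into a sum over all subsets of [T], independent or not. *)
Lemma hcZ_le_exp w T : (forall v, 0 <= w v) -> hcZ w T <= expR (\sum_(v in T) w v).
Proof.
move=> w0.
have -> : expR (\sum_(v in T) w v) = \prod_v (if v \in T then expR (w v) else 1).
  rewrite -big_mkcond/=; elim/big_rec2 : _ => [|v x y _ <-]; first by rewrite expR0.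
  by rewrite expRD.
apply: (@le_trans _ _ (\prod_v (1 + (if v \in T then w v else 0)))).
  under eq_bigr do rewrite addrC.
  rewrite bigA_distr /hcZ big_mkcond/=; apply: ler_sum => I _.
  case: ifPn => [/andP[_ IT]|_]; last first.
    by apply: prodr_ge0 => i _; case: ifP => // _; case: ifP.
  rewrite big_mkcond/=; apply: ler_prod => i _.
  case: ifPn => // iI; last by rewrite ler01/=.
  by rewrite (fintype.subsetP IT)// w0 /=.
apply: ler_prod => i _; case: ifP => _; last by rewrite addr0 ler01/=.
by rewrite addr_ge0//=; apply: expR_ge1Dx.
Qed.

(** Count independent sets with a marked element [v]: removing [v] leaves any independent set of
    [T :\: nbr v], which misses [v] by reflexivity. *)
Lemma hcA_nbr w T : hcA w T = \sum_(v in T) w v * hcZ w (T :\: nbr v).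
Proof.
rewrite /hcA.
under eq_bigr => I _ do rewrite -sum1_card natr_sum mulr_sumr.
rewrite (exchange_big_dep (mem T))/=; last first.
  by move=> I v /andP[_ /fintype.subsetP IT] /IT.
apply: eq_bigr => v vT.
rewrite (reindex_onto (fun I => v |: I) (fun I => I :\ v))/=; last first.
  by move=> I /andP[_ vI]; rewrite finset.setD1K.
rewrite mulr_sumr; apply: eq_big => [I|I]; last first.
  move=> /andP[/andP[_ _] /eqP <-].
  by rewrite mulr1 big_setU1 ?inE ?eqxx//= setU1K// !inE eqxx.
apply/idP/idP.
  move=> /andP[/andP[/andP[iI /fintype.subsetP IT] _] /eqP hI].
  rewrite (indepS _ iI) ?finset.subsetUr//=.
  apply/fintype.subsetP => x xI; rewrite !inE IT ?inE ?xI ?orbT//= andbT.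
  move/indepP: iI => /(_ v x); rewrite !inE eqxx xI orbT => /(_ isT isT); apply.
  by move: xI; rewrite -hI !inE eq_sym => /andP[].
move=> /andP[iI /fintype.subsetP IT].
have vI : v \notin I by apply/negP => /IT; rewrite !inE e_refl.
rewrite setU1K// eqxx andbT finset.setU11 andbT.
have nIv j : j \in I -> ~~ e v j by move=> /IT; rewrite !inE => /andP[].
apply/andP; split.
  apply/indepP => i j; rewrite !inE => /orP[/eqP->|iI'] /orP[/eqP->|jI'].
  - by rewrite eqxx.
  - by move=> _; apply: nIv.
  - by move=> _; rewrite e_sym; apply: nIv.
  - by move: i j iI' jI'; apply/indepP.
apply/fintype.subsetP => x; rewrite !inE => /orP[/eqP->//|/IT].
by rewrite inE => /andP[].
Qed.

(** By [hcZ_submul], the ratio of [hcZ w (T :\: nbr u)] to [hcZ w T] is at least the inverse of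
    [hcZ w (T :&: nbr u)], hence at least [expR (- s) >= 1 - s], with [s] the weight of
    [T :&: nbr u]. *)
Lemma hcA_ge w T : (forall v, 0 <= w v) ->
  (\sum_(u in T) w u - \sum_(u in T) w u * \sum_(v in T | e u v) w v) * hcZ w T
    <= hcA w T.
Proof.
move=> w0; rewrite hcA_nbr -sumrB mulr_suml; apply: ler_sum => u uT.
rewrite -{1}[w u]mulr1 -mulrBr -mulrA ler_wpM2l//.
have -> : \sum_(v in T | e u v) w v = \sum_(v in T :&: nbr u) w v.
  by apply: eq_bigl => v; rewrite !inE.
set s := \sum_(_ in _) _.
have hs : hcZ w (T :&: nbr u) <= expR s by exact: hcZ_le_exp.
case: (lerP (1 - s) 0) => [h|h].
  by apply: (@le_trans _ _ 0); [apply: mulr_le0_ge0 => //|]; apply: hcZ_ge0.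
apply: (le_trans (ler_wpM2l (ltW h) (hcZ_submul (nbr u) T w0))).
rewrite mulrCA ger_pMr; last by apply: lt_le_trans (hcZ_ge1 _ w0).
apply: (le_trans (ler_wpM2l (ltW h) hs)).
have : 1 - s <= expR (- s) by exact: expR_ge1Dx.
by move=> /(ler_wpM2r (expR_ge0 s)) /le_trans; apply; rewrite -expRD addNr expR0.
Qed.

(** The mean size increases with the activity. Symmetrising the double sum over [I] and [J] produces
    the factor [(#|J| - #|I|) * (g ^+ #|I| - g ^+ #|J|)], which is nonnegative. *)
Lemma hcA_scale w T (g : R) : (forall v, 0 <= w v) -> 0 <= g <= 1 ->
  hcA (fun v => g * w v) T * hcZ w T <= hcA w T * hcZ (fun v => g * w v) T.
Proof.
move=> w0 /andP[g0 g1].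
pose p I := \prod_(i in I) w i.
have pE I : \prod_(i in I) (g * w i) = g ^+ #|I| * p I.
  by rewrite big_split/= prodr_const.
rewrite -subr_ge0 /hcA /hcZ !big_distrlr/= [X in _ - X]exchange_big/= -sumrB.
under eq_bigr => I _ do rewrite -sumrB.
set P := fun I => _.
set X := \sum_(_ | _) _.
suff : 0 <= X + X by move=> h; rewrite -(@pmulr_rge0 _ 2)// mulr_natl mulr2n.
rewrite {1}/X exchange_big/= /X -big_split/=; apply: sumr_ge0 => I _.
rewrite -big_split/=; apply: sumr_ge0 => J _.
rewrite !pE -/(p I) -/(p J).
rewrite [leRHS](_ : _ =
  p I * p J * ((#|J|%:R - #|I|%:R) * (g ^+ #|I| - g ^+ #|J|))); last by ring.
apply: mulr_ge0; first by apply: mulr_ge0; apply: prodr_ge0.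
case: (leqP #|I| #|J|) => h.
  by rewrite mulr_ge0// subr_ge0 ?ler_nat// ler_wiXn2l.
by rewrite mulr_le0// subr_le0 ?ler_nat ?ler_wiXn2l// ltnW.
Qed.

(** Average the local inequality over the random set [T] left free in [nbr v], then over [v] with
    weight [w v]. Its right side becomes at most [1 + b * D] times the mean size of the random
    independent set, which a largest independent set attains. *)
Lemma hc_large_indep w (a b D : R) :
  (forall v, 0 <= w v) -> 0 <= b -> 0 <= D ->
  (forall v, \sum_(u in nbr v) w u <= D) ->
  (forall T, a * hcZ w T <= 1 + b * hcA w T) ->
  exists2 I, indep I & a * \sum_v w v <= #|I|%:R * (1 + b * D).
Proof.
move=> w0 b0 D0 hD hT.
pose p I := \prod_(i in I) w i.
have p0 I : 0 <= p I by exact: prodr_ge0.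
(* Condition on the part [J] outside [nbr v] and apply [hT] to the vertices of [nbr v] that [J] does
   not block. *)
have step v : a * hcZ w finset.setT <= hcZ w (finset.setT :\: nbr v) +
    b * \sum_(I | indep I && (I \subset finset.setT)) p I * #|I :&: nbr v|%:R.
  have h1 := indep_decomp (nbr v) finset.setT (fun K J => p K * p J).
  have h2 := indep_decomp (nbr v) finset.setT (fun K J => p K * p J * #|K|%:R).
  have pI I : p I = p (I :&: nbr v) * p (I :\: nbr v) by rewrite -big_setID.
  rewrite {1}/hcZ; under eq_bigr => I _ do rewrite -/(p _) pI.
  under [X in _ <= _ + b * X]eq_bigr => I _ do rewrite pI.
  rewrite h1 h2 /hcZ !mulr_sumr -big_split/=; apply: ler_sum => J _.
  set T := _ :\: nbrs J.
  rewrite (_ : \sum_(_ | _) _ = p J * hcZ w T); last first.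
    by rewrite mulr_sumr; apply: eq_bigr => K _; rewrite mulrC.
  rewrite (_ : \sum_(_ | _) _ = p J * hcA w T); last first.
    by rewrite mulr_sumr; apply: eq_bigr => K _; rewrite [p K * _]mulrC mulrA.
  by rewrite -/(p J) mulrCA [b * _]mulrCA -{2}[p J]mulr1 -mulrDr ler_wpM2l.
have hA : hcA w finset.setT = \sum_(I | indep I && (I \subset finset.setT)) p I * #|I|%:R.
  by [].
have big : a * (\sum_v w v) * hcZ w finset.setT <= (1 + b * D) * hcA w finset.setT.
  rewrite mulrAC mulr_sumr mulrDl mul1r {1}hcA_nbr.
  apply: (@le_trans _ _ (\sum_v (w v * hcZ w (finset.setT :\: nbr v) + w v *
      (b * \sum_(I | indep I && (I \subset finset.setT)) p I * #|I :&: nbr v|%:R)))).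
    by apply: ler_sum => v _; rewrite -mulrDr mulrC ler_wpM2l.
  rewrite big_split/= lerD//.
    by rewrite le_eqVlt; apply/orP; left; apply/eqP/eq_bigl => v; rewrite inE.
  under eq_bigr => v _ do rewrite mulrCA mulr_sumr.
  rewrite -mulr_sumr exchange_big/= -mulrA ler_wpM2l// hA mulr_sumr.
  apply: ler_sum => I _.
  under eq_bigr => v _ do rewrite mulrCA.
  rewrite -mulr_sumr [leRHS]mulrCA ler_wpM2l//.
  (* Double counting: each [u] in [I] is charged to the [v] with [u] in [nbr v], of total weight at
     most [D]. *)
  under eq_bigr => v _ do rewrite -sum1_card natr_sum mulr_sumr.
  rewrite (exchange_big_dep (mem I))/=; last by move=> v u _; rewrite inE => /andP[].
  rewrite -sum1_card natr_sum mulr_sumr; apply: ler_sum => u uI.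
  rewrite mulr1; apply: le_trans (hD u).
  rewrite le_eqVlt; apply/orP; left; apply/eqP; apply: eq_big => v; last by rewrite mulr1.
  by rewrite !inE uI e_sym.
case: (@arg_maxnP _ finset.set0 indep (fun I => #|I|) indep0) => I iI hI.
exists I => //; rewrite -(ler_pM2r (lt_le_trans ltr01 (hcZ_ge1 finset.setT w0))).
apply: (le_trans big); rewrite -mulrA mulrCA.
rewrite ler_wpM2l//; first by rewrite addr_ge0// mulr_ge0.
rewrite hA /hcZ mulr_sumr; apply: ler_sum => J /andP[iJ _].
by rewrite mulrC ler_wpM2r// ler_nat; apply: hI.
Qed.

End HardCore.

(** * Adjacent pairs of unit vectors in a heavy set *)

Section Dotp.
Local Open Scope ring_scope.
Variables (R : realType) (d : nat).
Implicit Types x y z : 'rV[R]_d.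

Lemma dotpC x y : dotp x y = dotp y x.
Proof. by apply: eq_bigr => i _; rewrite mulrC. Qed.

Lemma dotpDl x y z : dotp (x + y) z = dotp x z + dotp y z.
Proof. by rewrite -big_split; apply: eq_bigr => i _; rewrite mxE mulrDl. Qed.

Lemma dotpDr x y z : dotp z (x + y) = dotp z x + dotp z y.
Proof. by rewrite dotpC dotpDl ![dotp z _]dotpC. Qed.

Lemma dotpZl a x y : dotp (a *: x) y = a * dotp x y.
Proof. by rewrite mulr_sumr; apply: eq_bigr => i _; rewrite mxE mulrA. Qed.

Lemma dotpZr a x y : dotp x (a *: y) = a * dotp x y.
Proof. by rewrite dotpC dotpZl dotpC. Qed.

Lemma dotp0l x : dotp 0 x = 0.
Proof. by rewrite -(scale0r 0) dotpZl mul0r. Qed.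

Lemma dotp_ge0 x : 0 <= dotp x x.
Proof. by apply: sumr_ge0 => i _; rewrite -expr2 sqr_ge0. Qed.

Lemma sphereP x : sphere R d x <-> dotp x x = 1.
Proof.
rewrite /sphere /enorm/=; split => [h|->]; last by rewrite sqrtr1.
by rewrite -[LHS]sqr_sqrtr ?dotp_ge0// h expr1n.
Qed.

Lemma dotp_unit_sqr_le x y : dotp y y = 1 -> dotp x y ^+ 2 <= dotp x x.
Proof.
move=> y1; have := dotp_ge0 (x - dotp x y *: y).
rewrite -scaleN1r scalerA !(dotpDl, dotpDr, dotpZl, dotpZr) y1 (dotpC y x).
by move=> h; lra.
Qed.

End Dotp.

Section PairBound.
Local Open Scope ring_scope.
Variables (R : realType) (d : nat) (V : finType) (y : V -> 'rV[R]_d).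
Hypothesis y1 : forall i, dotp (y i) (y i) = 1.
Variables (p : V -> R) (t c B : R).
Hypothesis p0 : forall i, 0 <= p i.
Hypotheses (t0 : 0 <= t) (c0 : 0 < c) (B0 : 0 < B).
(** By Markov's inequality every cap of height [c] has mass at most [B]; the same bound drives the
    Chernoff estimate. *)
Hypothesis mgf : forall v, dotp v v <= 1 ->
  \sum_j p j * expR (t * dotp v (y j)) <= B * expR (t * c).
Variable T : {set V}.

(** Integration over [m]-tuples of elements of [T] against the product of the weights [p], one entry
    at a time. *)
Fixpoint tupsum (m : nat) (F : seq V -> R) : R :=
  if m is m'.+1 then \sum_(v in T) p v * tupsum m' (fun s => F (v :: s))
  else F [::].

Lemma tupsum_le m F G : (forall s, size s = m -> F s <= G s) ->
  tupsum m F <= tupsum m G.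
Proof.
elim: m F G => [|m IH] F G FG /=; first exact: FG.
apply: ler_sum => v _; rewrite ler_wpM2l//; apply: IH => s sm.
by apply: FG; rewrite /= sm.
Qed.

Lemma tupsumD m F G : tupsum m (fun s => F s + G s) = tupsum m F + tupsum m G.
Proof.
elim: m F G => [//|m IH] F G /=.
by rewrite -big_split/=; apply: eq_bigr => v _; rewrite IH mulrDr.
Qed.

Lemma tupsumZ m a F : tupsum m (fun s => a * F s) = a * tupsum m F.
Proof.
elim: m F => [//|m IH] F /=.
by rewrite mulr_sumr; apply: eq_bigr => v _; rewrite IH mulrCA.
Qed.

Lemma tupsum_sum m (f : V -> R) (F : V -> seq V -> R) :
  tupsum m (fun s => \sum_(u in T) f u * F u s) =
  \sum_(u in T) f u * tupsum m (F u).
Proof.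
elim: m F => [//|m IH] F /=.
under eq_bigr => v _ do rewrite IH mulr_sumr.
rewrite exchange_big/=; apply: eq_bigr => u _.
by rewrite mulr_sumr; apply: eq_bigr => v _; rewrite mulrCA.
Qed.

Lemma tupsum_prod m (f : V -> R) :
  tupsum m (fun s => \prod_(v <- s) f v) = (\sum_(v in T) p v * f v) ^+ m.
Proof.
elim: m => [|m IH] /=; first by rewrite big_nil.
rewrite exprS mulr_suml; apply: eq_bigr => v _.
rewrite -IH -mulrA; congr (_ * _); rewrite -tupsumZ; congr tupsum.
by apply/funext => s; rewrite big_cons.
Qed.

Variable K : R.
Hypothesis K1 : 1 <= K.

Let g (S : 'rV[R]_d) := Num.sqrt (K ^+ 2 + dotp S S).

Let gsqr S : g S ^+ 2 = K ^+ 2 + dotp S S.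
Proof. by rewrite sqr_sqrtr// addr_ge0 ?sqr_ge0 ?dotp_ge0. Qed.

Let g_ge S : K <= g S.
Proof.
rewrite -(@ler_pXn2r _ 2) ?nnegrE ?sqrtr_ge0//; last by rewrite (le_trans _ K1).
by rewrite gsqr lerDl dotp_ge0.
Qed.

(** With [a = g S] and [b = dotp S x], the square of [a + b / a + 1 / (2 a)] is
    [g (S + x) ^+ 2 = a ^+ 2 + 2 b + 1] plus a square. The bounds [a >= 1] and [b >= - a] make the
    base positive, and [a >= K] gives the last term. *)
Let g_step S x : dotp x x = 1 ->
  g (S + x) <= g S + dotp ((g S)^-1 *: S) x + (2 * K)^-1.
Proof.
move=> x1; have a1 : 1 <= g S by apply: le_trans (g_ge S).
have a0 : 0 < g S by apply: lt_le_trans a1.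
have K0 : 0 < K by apply: lt_le_trans K1.
rewrite dotpZl; set b := dotp S x; set a := g S in a1 a0 *.
have bS : b ^+ 2 <= a ^+ 2.
  by rewrite gsqr (le_trans (dotp_unit_sqr_le _ x1))// lerDr sqr_ge0.
have : - a <= b.
  rewrite -(opprK b) lerN2; apply: le_trans (ler_norm _) _.
  by rewrite normrN -(@ler_pXn2r _ 2) ?nnegrE ?(ltW a0)// real_normK ?num_real.
move=> ba.
have ab : -1 <= a^-1 * b.
  by rewrite -(@ler_pM2l _ a)// mulrA mulfV ?gt_eqF// mul1r mulrN1.
have h : a + a^-1 * b + (2 * a)^-1 <= a + a^-1 * b + (2 * K)^-1.
  by rewrite lerD2l lef_pV2 ?posrE ?mulr_gt0// ler_pM2l// g_ge.
apply: le_trans h.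
have ia : 0 < (2 * a)^-1 by rewrite invr_gt0 mulr_gt0.
rewrite -(@ler_pXn2r _ 2) ?nnegrE ?sqrtr_ge0//; last lra.
have -> : g (S + x) ^+ 2 = a ^+ 2 + 2 * b + 1.
  rewrite !gsqr !(dotpDl, dotpDr) x1 (dotpC x S) -/b; ring.
rewrite -subr_ge0 [leRHS](_ : _ = (a^-1 * b + (2 * a)^-1) ^+ 2) ?sqr_ge0//.
by field; rewrite gt_eqF.
Qed.

(* Chernoff bound for [|y_1 + ... + y_m|] with the norm smoothed to
   [sqrt (K^2 + |S|^2)], so that one step adds at most a linear form plus
   [1 / (2 K)]. *)
Lemma tupsum_exp_norm m S :
  tupsum m (fun s => expR (t * g (S + \sum_(v <- s) y v))) <=
  expR (t * g S) * (B * expR (t * c) * expR (t * (2 * K)^-1)) ^+ m.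
Proof.
have K0 : 0 < K by apply: lt_le_trans K1.
elim: m S => [|m IH] S /=; first by rewrite big_nil addr0 mulr1.
set X := B * _ * _ in IH *.
have X0 : 0 <= X by rewrite !mulr_ge0 ?expR_ge0// ltW.
apply: (@le_trans _ _ (\sum_(v in T) p v * (expR (t * g (S + y v)) * X ^+ m))).
  apply: ler_sum => v _; rewrite ler_wpM2l//; apply: le_trans (IH (S + y v)).
  by apply: tupsum_le => s _; rewrite big_cons addrA.
rewrite exprS mulrA.
under eq_bigr => v _ do rewrite mulrA.
rewrite -mulr_suml ler_wpM2r ?exprn_ge0//.
have gS0 : 0 < g S by apply: lt_le_trans (g_ge S).
(* The gradient of the smoothed norm lies in the unit ball, so [mgf] applies to it. *)
have hv : dotp ((g S)^-1 *: S) ((g S)^-1 *: S) <= 1.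
  rewrite dotpZl dotpZr mulrA -invfM -expr2 gsqr mulrC ler_pdivrMr ?mul1r.
    by rewrite lerDr sqr_ge0.
  by rewrite -gsqr exprn_gt0.
have := mgf hv.
set e1 := expR (t * g S); set e2 := expR (t * (2 * K)^-1).
have e10 : 0 <= e1 by exact: expR_ge0.
have e20 : 0 <= e2 by exact: expR_ge0.
move=> /(ler_wpM2l (mulr_ge0 e10 e20)) h.
rewrite /X; apply: (le_trans _ (le_trans h _)); last first.
  by rewrite -mulrA ler_wpM2l// mulrC.
rewrite mulr_sumr big_mkcond/=; apply: ler_sum => v _.
case: ifP => _; last by rewrite !mulr_ge0 ?expR_ge0.
rewrite mulrCA ler_wpM2l// -!expRD ler_expR -!mulrDr ler_wpM2l//.
by rewrite addrAC; apply: g_step.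
Qed.

(* If the mean of [s] has norm at most [c], the common neighbourhood of [s] lies
   in a cap of height [c], of mass at most [B]; otherwise the last term is at
   least the mass of [T]. *)
Lemma common_nbr_mass (M : nat) s : size s = M -> (0 < M)%N ->
  \sum_(u in T) p u * \prod_(v <- s) (c ^+ 2 < dotp (y u) (y v))%R%:R <=
  B + (\sum_(u in T) p u) * expR (- (t * (M%:R * c))) *
        expR (t * g (0 + \sum_(v <- s) y v)).
Proof.
move=> sM M0; rewrite add0r; set S := \sum_(v <- s) y v.
have Mc0 : 0 < M%:R * c by rewrite mulr_gt0// ltr0n.
have dS u : all (fun v => c ^+ 2 < dotp (y u) (y v)) s -> M%:R * c ^+ 2 <= dotp (y u) S.
  move=> h; rewrite -sM /S; elim: (s) h => [|v l IH]/=.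
    by rewrite mul0r big_nil dotpC dotp0l.
  move=> /andP[h1 h2]; rewrite big_cons dotpDr -natr1 mulrDl mul1r addrC.
  by rewrite lerD ?IH// ltW.
have prodE u : \prod_(v <- s) (c ^+ 2 < dotp (y u) (y v))%R%:R =
    (all (fun v => c ^+ 2 < dotp (y u) (y v))%R s)%:R :> R.
  elim: (s) => [|v l IH]/=; first by rewrite big_nil.
  by rewrite big_cons IH -natrM mulnb.
have [h|h] := lerP (dotp S S) ((M%:R * c) ^+ 2).
  apply: (@le_trans _ _ B); last first.
    by rewrite lerDl !mulr_ge0 ?expR_ge0// sumr_ge0.
  have hv : dotp ((M%:R * c)^-1 *: S) ((M%:R * c)^-1 *: S) <= 1.
    rewrite dotpZl dotpZr mulrA -invfM -expr2 mulrC ler_pdivrMr ?mul1r//.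
    exact: exprn_gt0.
  have := ler_wpM2r (expR_ge0 (- (t * c))) (mgf hv).
  rewrite -mulrA -expRD subrr expR0 mulr1; apply: le_trans.
  rewrite mulr_suml big_mkcond/=; apply: ler_sum => u _.
  case: ifP => _; last by rewrite !mulr_ge0 ?expR_ge0.
  rewrite prodE -mulrA ler_wpM2l//.
  case: (boolP (all _ s)) => [hu|_]; last by rewrite mulr_ge0 ?expR_ge0.
  rewrite -expRD -{1}expR0 ler_expR subr_ge0 ler_wpM2l//.
  rewrite dotpZl dotpC -(@ler_pM2l _ (M%:R * c))// mulrA mulfV ?gt_eqF// mul1r.
  by apply: le_trans (dS _ hu); rewrite -mulrA expr2.
rewrite -[leLHS]add0r lerD ?(ltW B0)// -mulrA -expRD.
apply: (@le_trans _ _ (\sum_(u in T) p u)).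
  apply: ler_sum => u _; rewrite -[leRHS]mulr1 ler_wpM2l// prodE.
  by case: all => //=; rewrite ler01.
rewrite -[leLHS]mulr1 ler_wpM2l ?sumr_ge0// -[leLHS]expR0 ler_expR.
rewrite addrC subr_ge0 ler_wpM2l//.
rewrite -(@ler_pXn2r _ 2) ?nnegrE ?sqrtr_ge0 ?(ltW Mc0)// gsqr.
by apply: le_trans (ltW h) _; rewrite lerDr sqr_ge0.
Qed.

End PairBound.

Section PairBound2.
Local Open Scope ring_scope.
Variable R : realType.

(** Convexity in tangent-line form; it plays the part of Jensen's inequality in [pair_bound]. *)
Lemma expr_tangent (x a : R) m : 0 <= x -> 0 <= a ->
  a ^+ m.+1 + m.+1%:R * a ^+ m * (x - a) <= x ^+ m.+1.
Proof.
move=> x0 a0; elim: m => [|m IH]; first by rewrite expr0 !expr1; lra.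
rewrite [leRHS]exprS; apply: le_trans (ler_wpM2l x0 IH).
rewrite -subr_ge0 [leRHS](_ : _ = m.+1%:R * a ^+ m * (x - a) ^+ 2).
  by rewrite mulr_ge0 ?sqr_ge0// mulr_ge0// exprn_ge0.
rewrite !exprS -[m.+2%:R]natr1; ring.
Qed.

(** If the pairs weighed more, then by convexity of the power the common neighbourhoods of
    [M ^ 2]-tuples of [T] would be heavy on average, against [common_nbr_mass] and the Chernoff
    bound. *)
Lemma pair_bound (d : nat) (V : finType) (y : V -> 'rV[R]_d) (p : V -> R)
    (t c B E del : R) (M : nat) (T : {set V}) :
  (forall i, dotp (y i) (y i) = 1) -> (forall i, 0 <= p i) ->
  0 <= t -> 0 < c -> 0 < B ->
  (forall v, dotp v v <= 1 ->
    \sum_j p j * expR (t * dotp v (y j)) <= B * expR (t * c)) ->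
  0 < E -> 0 <= del -> (0 < M)%N ->
  E^-1 + expR (2 * t * M%:R) / E ^+ (M ^ 2) < del ^+ (M ^ 2) ->
  E * B <= \sum_(u in T) p u ->
  \sum_(u in T) p u * \sum_(v in T | c ^+ 2 < dotp (y u) (y v)) p v <=
  del * (\sum_(u in T) p u) ^+ 2.
Proof.
move=> y1 p0 t0 c0 B0 mgf E0 del0 M0 hdel hE.
set tau := \sum_(u in T) p u in hE *.
set P := \sum_(u in T) _.
rewrite leNgt; apply/negP => hP.
have tau0 : 0 < tau by apply: lt_le_trans hE; rewrite mulr_gt0.
pose m := (M ^ 2)%N; have m0 : (0 < m)%N by rewrite expn_gt0 M0.
(* With smoothing [K = M] and tuples of length [m = M ^ 2], the start costs [t * K] and the drift
   [m * t / (2 K)], together below [2 * t * M]. *)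
pose K : R := M%:R; have K1 : 1 <= K by rewrite ler1n.
have K0 : 0 < K by apply: lt_le_trans K1.
pose deg u := \sum_(v in T) p v * (c ^+ 2 < dotp (y u) (y v))%R%:R.
have degE u : deg u = \sum_(v in T | c ^+ 2 < dotp (y u) (y v)) p v.
  rewrite /deg big_mkcondr/=; apply: eq_bigr => v _.
  by case: ifP; rewrite ?mulr1 ?mulr0.
have low : tau * (del * tau) ^+ m <= \sum_(u in T) p u * deg u ^+ m.
  rewrite -[m]prednK//; set a := del * tau; set m' := m.-1.
  have a0 : 0 <= a by rewrite mulr_ge0// ltW.
  apply: (@le_trans _ _ (\sum_(u in T)
      p u * (a ^+ m'.+1 + m'.+1%:R * a ^+ m' * (deg u - a)))); last first.
    apply: ler_sum => u _; rewrite ler_wpM2l//; apply: expr_tangent => //.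
    by apply: sumr_ge0 => v _; rewrite mulr_ge0.
  under eq_bigr => u _ do rewrite mulrDr mulrCA mulrBr.
  rewrite big_split/= -mulr_suml lerDl -mulr_sumr mulr_ge0//.
    by rewrite mulr_ge0// exprn_ge0.
  rewrite sumrB -mulr_suml -/tau subr_ge0 /a mulrCA -expr2.
  under eq_bigr => u _ do rewrite degE.
  exact: ltW.
(* The [m]-th moment of the degree is the integral over [m]-tuples of the mass of their common
   neighbourhood. *)
have up : \sum_(u in T) p u * deg u ^+ m <=
    B * tau ^+ m + tau * (B ^+ m * expR (2 * t * M%:R)).
  have -> : \sum_(u in T) p u * deg u ^+ m = tupsum p T m (fun s =>
      \sum_(u in T) p u * \prod_(v <- s) (c ^+ 2 < dotp (y u) (y v))%R%:R).
    rewrite tupsum_sum; apply: eq_bigr => u _; congr (_ * _).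
    by rewrite tupsum_prod.
  have cm s : size s = m -> _ := fun sm => common_nbr_mass p0 t0 c0 B0 mgf T K sm m0.
  apply: le_trans; first by apply: tupsum_le => // s; apply: cm.
  rewrite tupsumD lerD//.
    rewrite (_ : (fun _ => B) = fun s => B * \prod_(v <- s) 1); last first.
      by apply/funext => s; rewrite big1_eq mulr1.
    rewrite tupsumZ tupsum_prod ler_wpM2l ?(ltW B0) ?(ltW tau0)//.
    by under eq_bigr do rewrite mulr1.
  rewrite tupsumZ -mulrA ler_wpM2l ?(ltW B0) ?(ltW tau0)//.
  have := tupsum_exp_norm y1 p0 t0 B0 mgf T K1 m 0.
  move=> /(ler_wpM2l (expR_ge0 (- (t * (m%:R * c))))) /le_trans; apply.
  rewrite dotp0l addr0 sqrtr_sqr ger0_norm ?(ltW K0)// !exprMn -!expRM_natl.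
  rewrite [leLHS](_ : _ = B ^+ m * (expR (- (t * (m%:R * c))) * expR (t * K) *
    expR (m%:R * (t * c)) * expR (m%:R * (t * (2 * K)^-1)))); last by ring.
  rewrite ler_wpM2l ?exprn_ge0 ?(ltW B0)// -!expRD ler_expR.
  have -> : m%:R = K ^+ 2 by rewrite /m natrX.
  rewrite -subr_ge0 -/K [leRHS](_ : _ = t * K / 2); last by field; rewrite gt_eqF.
  by rewrite !mulr_ge0// ltW.
have BE : B <= tau / E by rewrite ler_pdivlMr// mulrC.
have : tau ^+ m.+1 * del ^+ m <=
    tau ^+ m.+1 * (E^-1 + expR (2 * t * M%:R) / E ^+ m).
  rewrite exprMn mulrCA in low.
  rewrite [leLHS](_ : _ = del ^+ m * (tau * tau ^+ m)); last by rewrite exprS mulrC.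
  apply: (le_trans low); apply: (le_trans up); rewrite mulrDr lerD//.
    by rewrite exprS mulrAC ler_wpM2r// exprn_ge0// ltW.
  rewrite exprS -!mulrA ler_wpM2l ?(ltW tau0)// [leLHS]mulrC [leRHS]mulrCA.
  rewrite ler_wpM2l ?expR_ge0//.
  rewrite -expr_div_n; apply: lerXn2r => //; rewrite nnegrE ?(ltW B0)//.
  by rewrite divr_ge0 ?(ltW tau0) ?(ltW E0).
rewrite ler_pM2l ?exprn_gt0//.
by rewrite leNgt hdel.
Qed.

End PairBound2.

(** * From the hard-core model to a large code *)

Section LargeCode.
Local Open Scope ring_scope.

(** At activity [1 / (B * E ^+ 2)], a set [T] of weight [z] has [1 / hcZ >= expR (- z)] and, unless
    it is light, mean size at least [z * (1 - del * z)]. The tangent to [expR (- z)] at [y0]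
    combines the two into the local inequality of [hc_large_indep]. *)
Lemma exists_large_code (R : realType) (d : nat) (V : finType)
    (y : V -> 'rV[R]_d) (p : V -> R) (t c B E del D y0 : R) (M : nat) :
  (forall i, dotp (y i) (y i) = 1) -> (forall i, 0 <= p i) -> \sum_i p i = 1 ->
  0 <= t -> 0 < c < 1 -> 0 < B ->
  (forall v, dotp v v <= 1 ->
    \sum_j p j * expR (t * dotp v (y j)) <= B * expR (t * c)) ->
  0 < E -> 0 <= del -> (0 < M)%N ->
  E^-1 + expR (2 * t * M%:R) / E ^+ (M ^ 2) < del ^+ (M ^ 2) ->
  0 <= D -> (forall i, \sum_(j | c ^+ 2 < dotp (y i) (y j)) p j <= D) ->
  0 <= y0 -> expR (- y0) * (1 + y0) <= expR (- E^-1) -> del * (1 + y0) < 1 ->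
  exists2 I : {set V},
    {in I &, forall i j, i != j -> dotp (y i) (y j) <= c ^+ 2} &
    expR (- y0) * (1 + y0) / (B * E ^+ 2) <=
    #|I|%:R * (1 + expR (- y0) / (1 - del * (1 + y0)) * (D / (B * E ^+ 2))).
Proof.
move=> y1 p0 p1 t0 /andP[c0 c1] B0 mgf E0 del0 M0 hdel D0 hD y00 hy0 dy.
pose e : rel V := fun i j => c ^+ 2 < dotp (y i) (y j).
have er : reflexive e by move=> i; rewrite /e y1 expr_lt1// ltW.
have es : symmetric e by move=> i j; rewrite /e dotpC.
pose l := (B * E ^+ 2)^-1.
have l0 : 0 < l by rewrite invr_gt0 mulr_gt0// exprn_gt0.
pose w v := l * p v.
have w0 v : 0 <= w v by rewrite mulr_ge0// ltW.
set b := expR (- y0) / _.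
have db : 0 < 1 - del * (1 + y0) by rewrite subr_gt0.
have b0 : 0 <= b by rewrite divr_ge0 ?expR_ge0 ?(ltW db).
have bE : b * (1 - del * (1 + y0)) = expR (- y0) by rewrite divfK// gt_eqF.
have hwD v : \sum_(u in nbr e v) w u <= l * D.
  rewrite -mulr_sumr ler_wpM2l ?(ltW l0)//; apply: le_trans (hD v).
  by under eq_bigl do rewrite inE.
have lD0 : 0 <= l * D by rewrite mulr_ge0// ltW.
suff hT T : expR (- y0) * (1 + y0) * hcZ e w T <= 1 + b * hcA e w T.
  have [I iI hI] := hc_large_indep er es w0 b0 lD0 hwD hT.
  exists I => [i j iI' jI' ij|].
    by move/indepP: iI => /(_ i j iI' jI' ij); rewrite /e -leNgt.
  by move: hI; rewrite -mulr_sumr p1 mulr1 [D / _]mulrC.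
set tau := \sum_(u in T) p u.
have tau0 : 0 <= tau by exact: sumr_ge0.
have wT : \sum_(u in T) w u = l * tau by rewrite -mulr_sumr.
have Z1 := hcZ_ge1 e T w0.
have Z0 : 0 < hcZ e w T by apply: lt_le_trans Z1.
have A0 := hcA_ge0 e T w0.
have ZE : hcZ e w T <= expR (l * tau) by rewrite -wT; apply: hcZ_le_exp.
(* For a light set [hcZ] is at most [expR (E^-1)], so the term [1] suffices. *)
have [hsmall|hbig] := ltrP tau (E * B).
  apply: (@le_trans _ _ 1); last by rewrite lerDl mulr_ge0.
  apply: (@le_trans _ _ (expR (- E^-1) * expR (E^-1))); last by rewrite -expRD addNr expR0.
  rewrite ler_pM// ?mulr_ge0 ?expR_ge0 ?(ltW Z0) ?addr_ge0//.
  apply: (le_trans ZE); rewrite ler_expR.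
  apply: (@le_trans _ _ (l * (E * B))); first by rewrite ler_wpM2l// ltW.
  by rewrite le_eqVlt; apply/orP; left; apply/eqP; rewrite /l; field; rewrite !gt_eqF.
have pb := pair_bound y1 p0 t0 c0 B0 mgf E0 del0 M0 hdel hbig.
have scaled (g : R) : 0 <= g ->
    g * (l * tau) * (1 - del * (g * (l * tau))) * hcZ e (fun v => g * w v) T
      <= hcA e (fun v => g * w v) T.
  move=> g0; have gw0 v : 0 <= g * w v by rewrite mulr_ge0.
  apply: le_trans (hcA_ge er es T gw0); rewrite ler_wpM2r ?hcZ_ge0//.
  rewrite mulrBr mulr1 lerB//; first by rewrite -mulr_sumr wT.
  under eq_bigr => u _ do rewrite -mulr_sumr -mulr_sumr /w -!mulrA
    [p u * _]mulrCA [p u * _]mulrCA.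
  rewrite -!mulr_sumr.
  apply: (le_trans (ler_wpM2l g0 (ler_wpM2l (ltW l0) (ler_wpM2l g0
    (ler_wpM2l (ltW l0) pb))))).
  by rewrite le_eqVlt; apply/orP; left; apply/eqP; rewrite -/tau; ring.
have [hY|hY] := lerP (l * tau) (1 + y0).
  have := scaled 1 ler01; rewrite mul1r.
  under [fun v => _]eq_fun do rewrite mul1r.
  set z := l * tau in hY ZE *; move=> hA.
  have z0 : 0 <= z by rewrite mulr_ge0// ltW.
  (* The tangent to [expR (- z)] at [y0]. *)
  have h1 : expR (- y0) * (1 + y0 - z) <= expR (- z).
    have := expR_ge1Dx (y0 - z); rewrite addrA.
    move=> /(ler_wpM2l (expR_ge0 (- y0))) /le_trans; apply.
    by rewrite -expRD addrA addNr add0r.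
  have h2 : expR (- y0) * (1 + y0 - z) * hcZ e w T <= 1.
    apply: (le_trans (ler_wpM2r (ltW Z0) h1)).
    apply: (le_trans (ler_wpM2l (expR_ge0 _) ZE)).
    by rewrite -expRD addNr expR0.
  have h3 : expR (- y0) * z * hcZ e w T <= b * hcA e w T.
    apply: le_trans (ler_wpM2l b0 hA).
    apply: (@le_trans _ _ (b * (z * (1 - del * (1 + y0)) * hcZ e w T))).
      by rewrite -bE le_eqVlt; apply/orP; left; apply/eqP; ring.
    apply: ler_wpM2l => //; apply: ler_wpM2r; first exact: ltW.
    by apply: ler_wpM2l => //; rewrite lerD2l lerN2 ler_wpM2l.
  by move: h2 h3; set q := hcZ e w T; set aa := hcA e w T; lra.
have ltau0 : 0 < l * tau by apply: le_lt_trans hY; rewrite addr_ge0.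
(* For a heavy set, lower the activity until the weight is [1 + y0]; by [hcA_scale] this does not
   raise the mean size, and the term in [hcA] alone suffices. *)
pose g := (1 + y0) / (l * tau).
have g0 : 0 <= g by rewrite divr_ge0 ?(ltW ltau0)// addr_ge0.
have g1 : g <= 1 by rewrite ler_pdivrMr// mul1r ltW.
have := scaled g g0; rewrite (_ : g * (l * tau) = 1 + y0); last first.
  by rewrite divfK// gt_eqF.
have Zg0 : 0 < hcZ e (fun v => g * w v) T.
  by apply: lt_le_trans (hcZ_ge1 e T _) => // v; rewrite mulr_ge0.
move=> /(ler_wpM2r (ltW Z0)) hA.
have g01 : 0 <= g <= 1 by rewrite g0.
have := le_trans hA (hcA_scale e T w0 g01).
rewrite mulrAC ler_pM2r// => /(ler_wpM2l b0) h.
apply: le_trans (le_trans _ h) _; last by rewrite lerDr.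
by rewrite -bE le_eqVlt; apply/orP; left; apply/eqP; ring.
Qed.

End LargeCode.

(** * Lebesgue measure on tuples *)

Local Open Scope classical_set_scope.
Local Open Scope ring_scope.

Lemma measurable_tcons (R : realType) (d : nat) :
  measurable_fun setT (fun p : measurableTypeR R * d.-tuple (measurableTypeR R) =>
    [tuple of p.1 :: p.2]).
Proof. exact: measurable_cons. Qed.

Section TupleMeasureStep.
Variables (R : realType) (d : nat).
Variable m : {sigma_finite_measure set (d.-tuple (measurableTypeR R)) -> \bar R}.
Local Open Scope ereal_scope.

Let tc := (fun p : measurableTypeR R * d.-tuple (measurableTypeR R) =>
    [tuple of p.1 :: p.2]).
Let nu := (@lebesgue_measure R \x m) : {measure set _ -> \bar R}.

Definition tcons_measure := pushforward nu tc.

Let mtc A : measurable A -> measurable (tc @^-1` A).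
Proof.
by move=> mA; rewrite -[X in measurable X]setTI; apply: measurable_tcons.
Qed.

Let tm0 : tcons_measure set0 = 0.
Proof. by rewrite /tcons_measure /pushforward preimage_set0 measure0. Qed.

Let tm_ge0 A : 0 <= tcons_measure A.
Proof. exact: (measure_ge0 nu). Qed.

Let tm_sigma : semi_sigma_additive tcons_measure.
Proof.
move=> F mF tF mUF; rewrite /tcons_measure /pushforward preimage_bigcup.
apply: (@measure_semi_sigma_additive _ _ _ nu (fun n => tc @^-1` F n)).
- by move=> n; exact: mtc.
- apply/trivIsetP => /= i j _ _ ij; rewrite -preimage_setI.
  by move/trivIsetP : tF => /(_ _ _ _ _ ij) ->//; rewrite preimage_set0.
- by rewrite -preimage_bigcup; exact: mtc.
Qed.

HB.instance Definition _ := isMeasure.Build _ _ _ tcons_measure tm0 tm_ge0 tm_sigma.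

Let tm_sfin : sigma_finite setT tcons_measure.
Proof.
have /sigma_finiteP[F [TF ndF Foo]] := sigma_finiteT (@lebesgue_measure R).
have /sigma_finiteP[G [TG ndG Goo]] := sigma_finiteT m.
pose ti (t : d.+1.-tuple (measurableTypeR R)) := (thead t, [tuple of behead t]).
have mti : measurable_fun setT ti.
  apply: measurable_fun_pair; last exact: measurable_behead.
  exact: measurable_tnth.
exists (fun n => ti @^-1` (F n `*` G n)).
  rewrite -preimage_bigcup; apply/seteqP; split => // t _ /=.
  have : setT (thead t) by []; rewrite TF => -[i _ Fi].
  have : setT [tuple of behead t] by []; rewrite TG => -[j _ Gj].
  exists (maxn i j) => //; split => /=.
    by move: Fi; apply/subsetPset/ndF/leq_maxl.
  by move: Gj; apply/subsetPset/ndG/leq_maxr.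
move=> n; have [mF Fn] := Foo n; have [mG Gn] := Goo n.
split.
  by rewrite -[X in measurable X]setTI; apply: mti => //; apply: measurableX.
apply: (@le_lt_trans _ _ (lebesgue_measure (F n) * m (G n))); last first.
  by rewrite lte_mul_pinfty// ge0_fin_numE.
rewrite -product_measure1E// le_eqVlt; apply/orP; left; apply/eqP.
rewrite /tcons_measure /pushforward; congr (nu _).
apply/seteqP; split => -[x t] /=; rewrite /ti /tc /=;
  by rewrite theadE (_ : [tuple of _] = t)//; apply: val_inj.
Qed.

HB.instance Definition _ := Measure_isSigmaFinite.Build _ _ _ tcons_measure tm_sfin.

End TupleMeasureStep.

(** Induction on the dimension equips the bare set function with the sigma-finite structure that
    Tonelli's theorem requires. *)
Lemma lebesgue_tuple_measure (R : realType) (d : nat) :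
  {m : {sigma_finite_measure set (d.-tuple (measurableTypeR R)) -> \bar R}
   | forall A, m A = lebesgue_tuple A}.
Proof.
elim: d => [|d [m hm]].
  by exists (dirac [tuple] : {sigma_finite_measure set _ -> \bar R}).
exists (tcons_measure m) => A /=.
rewrite /tcons_measure /pushforward /product_measure1/=.
by apply: eq_integral => x _ /=.
Qed.

(** * Affine changes of variable on the line *)

Section Leb1.
Variable R : realType.
Notation lam := (@lebesgue_measure R).
Local Open Scope ereal_scope.

Lemma measurable_affine (r b : R) :
  measurable_fun [set: measurableTypeR R] (fun x : measurableTypeR R =>
    (r * x + b)%R : measurableTypeR R).
Proof.
by apply: measurable_funD => //; apply: measurable_funM.
Qed.

(** By uniqueness of Lebesgue measure it is enough to compare half-open intervals. *)
Lemma lebesgue_affine (r b : R) (A : set (measurableTypeR R)) : (0 < r)%R -> measurable A ->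
  lam ((fun x => (r * x + b)%R) @^-1` A) = (r^-1)%:E * lam A.
Proof.
move=> r0 mA; pose f := (fun x : measurableTypeR R => (r * x + b)%R : measurableTypeR R).
have mf : measurable_fun setT f by exact: measurable_affine.
pose mu := measure_function_pushforward__canonical__measure_function_Measure lam mf.
pose r' : {nonneg R} := NngNum (ltW r0).
suff : lam A = mscale r' mu A.
  rewrite /mscale/= /pushforward -/f => ->.
  by rewrite muleA -EFinM mulVf ?gt_eqF// mul1e.
have := @lebesgue_measure_unique R (mscale r' mu) _ A mA; apply => X [[u v] /= _ <-].
rewrite /mscale/= /pushforward.
rewrite (_ : f @^-1` _ = `]((u - b) / r)%R, ((v - b) / r)%R]%classic); last first.
  apply/seteqP; split => x; rewrite /f /= !in_itv/= ltr_pdivrMr// ler_pdivlMr//;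
    by rewrite ltrBlDr lerBrDr mulrC.
rewrite !lebesgue_measure_itv/= !lte_fin ltr_pM2r ?invr_gt0// ltrD2r.
case: ifPn => _; last by rewrite mule0.
rewrite -!EFinD -EFinM; congr (_%:E).
by field; rewrite gt_eqF.
Qed.

Lemma integral_affine (r b : R) (g : measurableTypeR R -> \bar R) : (0 < r)%R ->
  measurable_fun setT g -> (forall x, 0 <= g x) ->
  \int[lam]_x g (r * x + b)%R = (r^-1)%:E * \int[lam]_x g x.
Proof.
move=> r0 mg g0.
have mf := measurable_affine r b.
pose mu := measure_function_pushforward__canonical__measure_function_Measure lam mf.
have ir0 : (0 <= r^-1)%R by rewrite invr_ge0 ltW.
pose k : {nonneg R} := NngNum ir0.
transitivity (\int[mscale k lam]_x g x); last by rewrite ge0_integral_mscale.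
transitivity (\int[pushforward lam (fun x : measurableTypeR R =>
      (r * x + b)%R : measurableTypeR R)]_x g x).
  by rewrite ge0_integral_pushforward.
apply: (@eq_measure_integral _ _ _ setT (mscale k lam) mu) => A mA _.
exact: lebesgue_affine.
Qed.

End Leb1.

(** * Plane linear maps that preserve Lebesgue measure *)

Section LebTuple.
Variable R : realType.
Local Notation T := (measurableTypeR R).
Local Notation lam := (@lebesgue_measure R).

Definition tcons d (x : T) (t : d.-tuple T) : d.+1.-tuple T := [tuple of x :: t].

Definition ttail d (t : d.+1.-tuple T) : d.-tuple T := [tuple of behead t].

Lemma thead_tcons d x (t : d.-tuple T) : thead (tcons x t) = x.
Proof. exact: theadE. Qed.

Lemma ttail_tcons d x (t : d.-tuple T) : ttail (tcons x t) = t.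
Proof. exact: val_inj. Qed.

Lemma tconsP d (t : d.+1.-tuple T) : t = tcons (thead t) (ttail t).
Proof. by rewrite /tcons /ttail -tuple_eta. Qed.

Definition leb d : {sigma_finite_measure set (d.-tuple T) -> \bar R} :=
  sval (lebesgue_tuple_measure R d).

Lemma lebE d (A : set (d.-tuple T)) : leb d A = lebesgue_tuple A.
Proof. by rewrite /leb; case: lebesgue_tuple_measure. Qed.

Lemma xsection_tcons d (A : set (d.+1.-tuple T)) x :
  xsection ((fun p : T * d.-tuple T => tcons p.1 p.2) @^-1` A) x =
  [set t : d.-tuple T | A (tcons x t)].
Proof. by apply/seteqP; split => t; rewrite /xsection /= inE. Qed.

Lemma lebS d (A : set (d.+1.-tuple T)) :
  (leb d.+1 A = \int[lam]_x leb d [set t : d.-tuple T | A (tcons x t)])%E.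
Proof.
rewrite lebE /= /pushforward /product_measure1; apply: eq_integral => x _ /=.
by rewrite xsection_tcons lebE.
Qed.

Lemma measurable_fun_tcons d0 (U : measurableType d0) d (f : U -> T) (g : U -> d.-tuple T) :
  measurable_fun setT f -> measurable_fun setT g ->
  measurable_fun setT (fun u => tcons (f u) (g u)).
Proof. exact: measurable_cons. Qed.

Lemma measurable_preimage_tcons d (A : set (d.+1.-tuple T)) : measurable A ->
  measurable ((fun p : T * d.-tuple T => tcons p.1 p.2) @^-1` A).
Proof.
by move=> mA; rewrite -[X in measurable X]setTI; apply: measurable_tcons.
Qed.

Lemma measurable_tsection d (A : set (d.+1.-tuple T)) x : measurable A ->
  measurable [set t : d.-tuple T | A (tcons x t)].
Proof.
move=> mA; rewrite -xsection_tcons; apply: measurable_xsection.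
exact: measurable_preimage_tcons.
Qed.

Lemma measurable_leb_tsection d (A : set (d.+1.-tuple T)) : measurable A ->
  measurable_fun setT (fun x : T => leb d [set t : d.-tuple T | A (tcons x t)]).
Proof.
move=> mA; have := measurable_fun_xsection (leb d) (measurable_preimage_tcons mA).
by congr (measurable_fun _ _); apply/funext => x /=; rewrite xsection_tcons.
Qed.

Definition lebpres d (f : d.-tuple T -> d.-tuple T) :=
  measurable_fun setT f /\
  forall A, measurable A -> leb d (f @^-1` A) = leb d A.

Lemma lebpres_id d : lebpres (@id (d.-tuple T)).
Proof. by split. Qed.

Lemma lebpres_comp d (f g : d.-tuple T -> d.-tuple T) :
  lebpres f -> lebpres g -> lebpres (f \o g).
Proof.
move=> [mf hf] [mg hg]; split; first exact: measurableT_comp.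
move=> A mA; rewrite comp_preimage hg ?hf//.
by rewrite -[X in measurable X]setTI; apply: mf.
Qed.

Lemma lebpres_lift d (f : d.-tuple T -> d.-tuple T) : lebpres f ->
  lebpres (fun t : d.+1.-tuple T => tcons (thead t) (f (ttail t))).
Proof.
move=> [mf hf]; split.
  apply: (@measurable_fun_tcons _ _ d (fun t : d.+1.-tuple T => thead t)
    (fun t => f (ttail t))); first exact: measurable_tnth.
  by apply: measurableT_comp => //; apply: measurable_behead.
move=> A mA; rewrite !lebS; apply: eq_integral => x _.
rewrite -(hf _ (measurable_tsection x mA)); congr (leb d _).
by apply/seteqP; split => t /=; rewrite thead_tcons ttail_tcons.
Qed.

Definition trans0 d b (t : d.+1.-tuple T) : d.+1.-tuple T :=
  tcons (thead t + b) (ttail t).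

Lemma trans0E d b x (t : d.-tuple T) :
  trans0 b (tcons x t) = tcons (x + b) t.
Proof. by rewrite /trans0 thead_tcons ttail_tcons. Qed.

Lemma leb_trans0 d b (A : set (d.+1.-tuple T)) : measurable A ->
  leb d.+1 (trans0 b @^-1` A) = leb d.+1 A.
Proof.
move=> mA; rewrite !lebS.
have := @integral_affine R 1 b _ ltr01 (measurable_leb_tsection mA).
rewrite invr1 mul1e => <- //.
apply: eq_integral => x _; congr (leb d _); apply/seteqP; split => t /=;
  by rewrite trans0E mul1r.
Qed.

(** A two by two matrix on the first two coordinates; shears, the swap and plane rotations are
    instances. *)
Definition lin2 d (a b c e : R) (t : d.+2.-tuple T) : d.+2.-tuple T :=
  let x := thead t in let y := thead (ttail t) in
  tcons (a * x + b * y) (tcons (c * x + e * y) (ttail (ttail t))).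

Lemma lin2E d a b c e x y (s : d.-tuple T) :
  lin2 a b c e (tcons x (tcons y s)) =
  tcons (a * x + b * y) (tcons (c * x + e * y) s).
Proof. by rewrite /lin2 !(thead_tcons, ttail_tcons). Qed.

Lemma tuple2P d (t : d.+2.-tuple T) :
  exists x y (s : d.-tuple T), t = (tcons x (tcons y s)).
Proof.
by exists (thead t), (thead (ttail t)), (ttail (ttail t)); rewrite -!tconsP.
Qed.

Lemma lin2_comp d a b c e a' b' c' e' :
  @lin2 d a b c e \o lin2 a' b' c' e' =
  lin2 (a * a' + b * c') (a * b' + b * e') (c * a' + e * c') (c * b' + e * e').
Proof.
apply/funext => t; have [x [y [s ->]]] := tuple2P t.
by rewrite /comp !lin2E; congr (tcons _ (tcons _ _)); ring.
Qed.

Lemma measurable_lin2 d a b c e : measurable_fun setT (@lin2 d a b c e).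
Proof.
have m0 : measurable_fun setT (fun t : d.+2.-tuple T => thead t) by exact: measurable_tnth.
have mb : measurable_fun setT (@ttail d.+1).
  exact: measurable_behead.
have m1 : measurable_fun setT (fun t : d.+2.-tuple T => thead (ttail t)).
  by apply: (measurableT_comp (measurable_tnth _)).
have ml u v : measurable_fun setT (fun t : d.+2.-tuple T =>
    (u * thead t + v * thead (ttail t) : T)).
  by apply: measurable_funD; apply: measurable_funM.
apply: measurable_fun_tcons => //; apply: measurable_fun_tcons => //.
by apply: (measurableT_comp (@measurable_behead _ _ _)).
Qed.

(** On each slice of constant first coordinate, a shear is a translation. *)
Lemma lebpres_shear d k : lebpres (@lin2 d 1 0 k 1).
Proof.
split; first exact: measurable_lin2.
move=> A mA; rewrite !lebS; apply: eq_integral => x _.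
rewrite -[RHS](leb_trans0 (k * x))//; last exact: measurable_tsection.
congr (leb _ _); apply/seteqP; split => t /=; rewrite (tconsP t);
  by rewrite lin2E trans0E mul1r mul0r addr0 mul1r [k * x + _]addrC.
Qed.

Lemma lebpres_swap d : lebpres (@lin2 d 0 1 1 0).
Proof.
split; first exact: measurable_lin2.
move=> A mA; rewrite !lebS.
pose f (p : T * T) := leb d [set s : d.-tuple T |
  A (tcons p.1 (tcons p.2 s))].
have mf : measurable_fun setT f.
  pose B := (fun q : (T * T) * d.-tuple T =>
    tcons q.1.1 (tcons q.1.2 q.2)) @^-1` A.
  have mB : measurable B.
    rewrite -[X in measurable X]setTI.
    suff h : measurable_fun setT (fun q : (T * T) * d.-tuple T =>
      tcons q.1.1 (tcons q.1.2 q.2)) by exact: h.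
    apply: measurable_fun_tcons; first exact: (measurableT_comp measurable_fst).
    apply: measurable_fun_tcons; first exact: (measurableT_comp measurable_snd).
    exact: measurable_snd.
  have := measurable_fun_xsection (leb d) mB.
  congr (measurable_fun _ _); apply/funext => p /=; congr (leb d _).
  by apply/seteqP; split => t; rewrite /xsection /= inE.
transitivity (\int[lam]_x \int[lam]_y f (y, x))%E.
  apply: eq_integral => x _; rewrite lebS; apply: eq_integral => y _.
  congr (leb d _); apply/seteqP; split => s /=;
    by rewrite lin2E !mul0r !mul1r add0r addr0.
rewrite -(@fubini_tonelli _ _ _ _ _ lam lam f)//.
by apply: eq_integral => x _; rewrite lebS.
Qed.

Lemma lebpres_rot d (c s : R) : c ^+ 2 + s ^+ 2 = 1 ->
  lebpres (@lin2 d c s (- s) c).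
Proof.
have up k : lebpres (@lin2 d 1 k 0 1).
  have := lebpres_comp (lebpres_swap d) (lebpres_comp (lebpres_shear d k) (lebpres_swap d)).
  by rewrite !lin2_comp; congr (lebpres (lin2 _ _ _ _)); ring.
(* The half-angle tangent used below does not exist for [c = -1]; that half-turn is the square of a
   quarter-turn. *)
wlog cN1 : c s / 1 + c != 0 => [hw cs1|cs1].
  have [c1|] := eqVneq (1 + c) 0; last by move=> h; apply: hw.
  have r : lebpres (@lin2 d 0 1 (- 1) 0) by apply: hw; rewrite ?addr0 ?oner_neq0//; ring.
  have s0 : s = 0.
    apply/eqP; rewrite -sqrf_eq0; apply/eqP.
    have -> : s ^+ 2 = 1 - c ^+ 2 by rewrite -cs1; ring.
    by rewrite (_ : c = -1) ?sqrrN ?expr1n ?subrr//; apply/eqP; rewrite -addr_eq0 addrC c1.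
  have := lebpres_comp r r; rewrite lin2_comp s0 (_ : c = -1); last first.
    by apply/eqP; rewrite -addr_eq0 addrC c1.
  by congr (lebpres (lin2 _ _ _ _)); ring.
(* The rotation is the product of three shears, with parameters
   [u = tan (angle / 2)], [- s] and [u]. *)
set u := s / (1 + c).
have us : u * s = 1 - c.
  have -> : u * s = s ^+ 2 / (1 + c) by rewrite /u; field.
  have -> : s ^+ 2 = 1 - c ^+ 2 by rewrite -cs1; ring.
  by field.
have uc : u * (1 + c) = s by rewrite /u divfK.
have := lebpres_comp (up u) (lebpres_comp (lebpres_shear d (- s)) (up u)).
rewrite !lin2_comp; congr (lebpres (lin2 _ _ _ _)).
- by rewrite !(mulr1, mul1r, mulr0, addr0, add0r) mulrN us; ring.
- rewrite !(mulr1, mul1r, mulr0, addr0, add0r).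
  rewrite (_ : u + u * _ = u * (1 + (1 - u * s))); last by ring.
  by rewrite us -uc; ring.
- ring.
- by rewrite !(mulr1, mul1r, mulr0, mul0r, addr0, add0r) mulNr mulrC us; ring.
Qed.

End LebTuple.

Lemma measurable_bool_set d (U : measurableType d) (f : U -> bool) :
  measurable_fun setT f -> measurable [set u | f u].
Proof. by move=> mf; have := mf measurableT [set true] I; rewrite setTI. Qed.

(** * Rotations, balls and cylinders *)

Section TupleGeometry.
Variable R : realType.
Local Notation T := (measurableTypeR R).
Local Notation lam := (@lebesgue_measure R).

Definition tdot d (v t : d.-tuple T) : R := \sum_(i < d) (tnth v i : R) * tnth t i.

Lemma tdot0 (v t : 0.-tuple T) : tdot v t = 0.
Proof. by rewrite /tdot big_ord0. Qed.

Lemma tdotS d x y (v t : d.-tuple T) :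
  tdot (tcons x v) (tcons y t) = (x : R) * y + tdot v t.
Proof.
rewrite /tdot big_ord_recl; congr (_ * _ + _).
by apply: eq_bigr => i _; rewrite !tnthS.
Qed.

Lemma tdot_ge0 d (t : d.-tuple T) : 0 <= tdot t t.
Proof. by apply: sumr_ge0 => i _; rewrite -expr2 sqr_ge0. Qed.

Lemma measurable_tdot d (v : d.-tuple T) : measurable_fun setT (fun t : d.-tuple T => tdot v t).
Proof.
apply: measurable_sum => i; apply: measurable_funM => //; exact: measurable_tnth.
Qed.

Lemma measurable_tnorm d : measurable_fun setT (fun t : d.-tuple T => tdot t t).
Proof.
by apply: measurable_sum => i; apply: measurable_funM; exact: measurable_tnth.
Qed.

(* The hyperplane coordinate [tdot v] becomes, up to the factor [|v|], the
   first coordinate after finitely many plane rotations. *)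
Lemma rot_axis_aux d (v : d.+1.-tuple T) : exists (r : R) f, [/\ lebpres f,
  r ^+ 2 = tdot v v, forall t, tdot v t = r * thead (f t) &
  forall t, tdot (f t) (f t) = tdot t t].
Proof.
elim: d v => [|d IH] v.
  exists (thead v), id; split; first exact: lebpres_id.
  - by rewrite (tconsP v) tdotS tdot0 addr0 thead_tcons expr2.
  - by move=> t; rewrite (tconsP v) (tconsP t) tdotS tdot0 addr0 !thead_tcons.
  - by [].
have [r' [f' [pf' r'2 f'1 f'iso]]] := IH (ttail v).
set x : R := thead v.
have vv : tdot v v = x ^+ 2 + r' ^+ 2 by rewrite {1 2}(tconsP v) tdotS -r'2 expr2.
set q := Num.sqrt (x ^+ 2 + r' ^+ 2).
have q2 : q ^+ 2 = x ^+ 2 + r' ^+ 2 by rewrite sqr_sqrtr// addr_ge0 ?sqr_ge0.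
have vt t : tdot v t = x * thead t + r' * thead (f' (ttail t)).
  by rewrite {1}(tconsP v) {1}(tconsP t) tdotS f'1.
have [q0|q0] := eqVneq q 0.
  exists 0, id; split => //.
    by rewrite vv -q2 q0.
  move=> t; rewrite vt mul0r; move/eqP: q2; rewrite q0 expr0n/= eq_sym.
  by rewrite paddr_eq0 ?sqr_ge0// !sqrf_eq0 => /andP[/eqP -> /eqP ->]; rewrite !mul0r addr0.
exists q, (lin2 (x / q) (r' / q) (- (r' / q)) (x / q) \o
  (fun t => tcons (thead t) (f' (ttail t)))).
have cs : (x / q) ^+ 2 + (r' / q) ^+ 2 = 1.
  by rewrite !expr_div_n -mulrDl -q2 divff// expf_neq0.
split.
- by apply: lebpres_comp; [exact: lebpres_rot|exact: lebpres_lift].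
- by rewrite q2.
- move=> t; rewrite vt /comp [f' (ttail t)]tconsP lin2E !thead_tcons.
  by field.
- move=> t; rewrite -[tdot t t](_ : tdot (tcons (thead t) (f' (ttail t)))
    (tcons (thead t) (f' (ttail t))) = _); last first.
    by rewrite tdotS f'iso [in RHS](tconsP t) tdotS.
  rewrite /comp [f' (ttail t)]tconsP lin2E !tdotS.
  move: (thead t : R) (thead (f' (ttail t)) : R) => a b.
  rewrite !addrA; congr (_ + _).
  by rewrite -[RHS]mul1r -cs; ring.
Qed.

Lemma rot_axis d (v : d.+2.-tuple T) : tdot v v = 1 -> exists f, [/\ lebpres f,
  forall t, tdot v t = thead (f t) & forall t, tdot (f t) (f t) = tdot t t].
Proof.
move=> v1; have [r [f [pf r2 f1 fiso]]] := rot_axis_aux v.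
have : (r == 1) || (r == -1) by rewrite -sqrf_eq1 r2 v1.
move=> /orP[/eqP r1|/eqP r1].
  by exists f; split => // t; rewrite f1 r1 mul1r.
(* A half-turn of the first two coordinates corrects the sign, whence the dimension at least 2. *)
exists (lin2 (-1) 0 (- 0) (-1) \o f); split.
- by apply: lebpres_comp => //; apply: lebpres_rot; ring.
- move=> t; rewrite f1 r1 /comp; have [x [y [s ->]]] := tuple2P (f t).
  by rewrite lin2E !thead_tcons mul0r addr0.
- move=> t; rewrite -[RHS]fiso /comp; have [x [y [s ->]]] := tuple2P (f t).
  by rewrite lin2E !tdotS; ring.
Qed.

Definition tscale d k (t : d.-tuple T) : d.-tuple T := map_tuple (fun x : T => (k * x : T)) t.

Lemma tscaleS d k x (t : d.-tuple T) : tscale k (tcons x t) = tcons (k * x) (tscale k t).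
Proof. exact: val_inj. Qed.

Lemma tdot_tscale d k (t : d.-tuple T) : tdot (tscale k t) (tscale k t) = k ^+ 2 * tdot t t.
Proof. by rewrite mulr_sumr; apply: eq_bigr => i _; rewrite !tnth_map; ring. Qed.

Lemma leb_tscale d (k : R) (A : set (d.-tuple T)) : 0 < k -> measurable A ->
  (leb R d (tscale k @^-1` A) = ((k ^- d)%:E * leb R d A))%E.
Proof.
move=> k0; elim: d A => [|d IH] A mA.
  rewrite expr0 invr1 mul1e; congr (leb R _ _); apply/seteqP.
  by split => t /=; rewrite [tscale k t]tuple0 [t]tuple0.
rewrite !lebS.
have mG := measurable_leb_tsection mA.
transitivity (\int[lam]_x ((k ^- d)%:E *
    leb R d [set t : d.-tuple T | A (tcons (k * x + 0)%R t)]))%E.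
  apply: eq_integral => x _; rewrite addr0 -IH; last exact: measurable_tsection.
  by congr (leb R _ _); apply/seteqP; split => t /=; rewrite tscaleS.
rewrite ge0_integralZl//; last 2 first.
- apply: (measurableT_comp mG (measurable_affine k 0)).
- by rewrite lee_fin invr_ge0 exprn_ge0// ltW.
rewrite (@integral_affine _ k 0 (fun x => leb R d [set t : d.-tuple T | A (tcons x t)]))//.
by rewrite muleA -EFinM exprS invfM mulrC.
Qed.

Definition tball d (r : R) : set (d.-tuple T) := [set t | tdot t t <= r ^+ 2].
Arguments tball : clear implicits.

Lemma measurable_tball d r : measurable (tball d r).
Proof.
apply: measurable_bool_set; apply: measurable_fun_ler => //.
exact: measurable_tnorm.
Qed.

Lemma leb_tball d (r : R) : 0 < r -> (leb R d (tball d r) = (r ^+ d)%:E * leb R d (tball d 1))%E.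
Proof.
move=> r0; have ir : 0 < r^-1 by rewrite invr_gt0.
rewrite -(_ : tscale r^-1 @^-1` tball d 1 = tball d r).
  by rewrite leb_tscale ?exprVn ?invrK//; apply: measurable_tball.
apply/seteqP; split => t; rewrite /tball /= tdot_tscale exprVn mulrC expr1n;
  by rewrite ler_pdivrMr ?mul1r// exprn_gt0.
Qed.

(** Cylinders have explicit volume; balls and cones over caps are compared with them, so that no cap
    integral has to be evaluated. *)
Definition tcyl d (a b r : R) : set (d.+1.-tuple T) :=
  [set t | a <= thead t <= b /\ tdot (ttail t) (ttail t) <= r ^+ 2].
Arguments tcyl : clear implicits.

Lemma lebX d (A : set (d.+1.-tuple T)) :
  leb R d.+1 A = (lam \x leb R d)%E ((fun p : T * d.-tuple T => tcons p.1 p.2) @^-1` A).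
Proof.
rewrite lebS /product_measure1; apply: eq_integral => x _ /=.
by rewrite xsection_tcons.
Qed.

Lemma tcylE d a b r : (fun p : T * d.-tuple T => tcons p.1 p.2) @^-1` tcyl d a b r =
  `[a, b]%classic `*` tball d r.
Proof.
by apply/seteqP; split => -[x t]; rewrite /tcyl /= in_itv/= thead_tcons ttail_tcons.
Qed.

Lemma leb_tcyl d (a b r : R) : a <= b -> 0 < r ->
  (leb R d.+1 (tcyl d a b r) = ((b - a) * r ^+ d)%:E * leb R d (tball d 1))%E.
Proof.
move=> ab r0; rewrite lebX tcylE product_measure1E//; last first.
  exact: measurable_tball.
rewrite [in LHS]leb_tball// muleA; congr (_ * _)%E; rewrite EFinM; congr (_ * _)%E.
transitivity (lam `[a, b]%classic); first by [].
rewrite lebesgue_measure_itv/= lte_fin.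
have [_|ba] := ltP a b; first by rewrite -EFinD.
by rewrite (_ : b = a) ?subrr//; apply/eqP; rewrite eq_le ab ba.
Qed.

Lemma measurable_tcyl d a b r : measurable (tcyl d a b r).
Proof.
rewrite -[X in measurable X]setTI.
have -> : tcyl d a b r = (fun t => (thead t, ttail t)) @^-1` (`[a, b]%classic `*` tball d r).
  by apply/seteqP; split => t; rewrite /tcyl /= in_itv.
have m : measurable_fun setT (fun t : d.+1.-tuple T => (thead t, ttail t)).
  apply: measurable_fun_pair; first exact: measurable_tnth.
  exact: measurable_behead.
by apply: m => //; apply: measurableX => //; apply: measurable_tball.
Qed.

End TupleGeometry.
Arguments tball : clear implicits.
Arguments tcyl : clear implicits.

(** * Volumes of spherical caps *)

Section CapVolume.
Variable R : realType.
Local Notation T := (measurableTypeR R).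

Lemma tdot_tcons d (t : d.+1.-tuple T) :
  tdot t t = (thead t : R) ^+ 2 + tdot (ttail t) (ttail t).
Proof. by rewrite {1 2}(tconsP t) tdotS expr2. Qed.

Lemma le_leb d (A B : set (d.-tuple T)) : measurable A -> measurable B ->
  A `<=` B -> (leb R d A <= leb R d B)%E.
Proof. by move=> mA mB AB; apply: le_measure; rewrite ?inE. Qed.

Lemma tball_sub_tcyl d : tball R d.+1 1 `<=` tcyl R d (-1) 1 1.
Proof.
move=> t; rewrite /tball /tcyl /= tdot_tcons expr1n.
have := tdot_ge0 (ttail t); set x : R := thead t; set q := tdot _ _ => q0 h.
by split; [apply/andP; split; nra|nra].
Qed.

Lemma leb_tball_bounds d : (0 < leb R d (tball R d 1) < +oo)%E.
Proof.
elim: d => [|d /andP[IH0 IHoo]].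
  rewrite lebE /= diracE mem_set ?lte01 ?ltry//.
  by rewrite /tball /= tdot0 expr1n.
apply/andP; split.
  apply: (@lt_le_trans _ _ (leb R d.+1 (tcyl R d 0 (1/2) (1/2)))).
    rewrite leb_tcyl; [|lra|lra].
    by rewrite mule_gt0// lte_fin mulr_gt0 ?exprn_gt0; lra.
  apply: le_leb; [exact: measurable_tcyl|exact: measurable_tball|].
  move=> t; rewrite /tball /tcyl /= tdot_tcons; set x : R := thead t.
  set q := tdot _ _ => -[/andP[h1 h2] h3]; nra.
apply: (@le_lt_trans _ _ (leb R d.+1 (tcyl R d (-1) 1 1))).
  by apply: le_leb; [exact: measurable_tball|exact: measurable_tcyl|exact: tball_sub_tcyl].
rewrite leb_tcyl; [|lra|lra].
by rewrite lte_mul_pinfty ?lee_fin// mulr_ge0 ?exprn_ge0; lra.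
Qed.

Definition vol d : R := fine (leb R d (tball R d 1)).

Lemma volE d : (leb R d (tball R d 1) = (vol d)%:E).
Proof.
have /andP[h1 h2] := leb_tball_bounds d.
by rewrite /vol fineK// ge0_fin_numE.
Qed.

Lemma vol_gt0 d : 0 < vol d.
Proof. by have /andP[h _] := leb_tball_bounds d; rewrite volE lte_fin in h. Qed.

(** This and the next two sets are the cones over the sphere, over a cap about a unit [v], and over
    a cap about the first axis. The origin is missing because [cone] asks for [0 < r]. *)
Definition tpunct d : set (d.-tuple T) := [set t | 0 < tdot t t <= 1].

Definition tcap d (v : d.-tuple T) (a : R) : set (d.-tuple T) :=
  [set t | 0 < tdot t t <= 1 /\ a * Num.sqrt (tdot t t) <= tdot v t].

Definition tcap0 d (a : R) : set (d.+1.-tuple T) :=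
  [set t | 0 < tdot t t <= 1 /\ a * Num.sqrt (tdot t t) <= thead t].
Arguments tcap0 : clear implicits.
Arguments tpunct : clear implicits.

Lemma measurable_tpunct d : measurable (tpunct d).
Proof.
have -> : tpunct d = [set t | 0 < tdot t t] `&` [set t | tdot t t <= 1].
  by apply/seteqP; split => t /=; rewrite /tpunct /=; [move=> /andP[]|move=> [-> ->]].
apply: measurableI; apply: measurable_bool_set.
  by apply: measurable_fun_ltr => //; apply: measurable_tnorm.
by apply: measurable_fun_ler => //; apply: measurable_tnorm.
Qed.

Lemma measurable_asqrt d (a : R) :
  measurable_fun setT (fun t : d.-tuple T => a * Num.sqrt (tdot t t)).
Proof.
apply: measurable_funM => //.
apply: (measurableT_comp (continuous_measurable_fun (@sqrt_continuous R))).
exact: measurable_tnorm.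
Qed.

Lemma measurable_tcap d (v : d.-tuple T) a : measurable (tcap v a).
Proof.
rewrite (_ : tcap v a = tpunct d `&` [set t | a * Num.sqrt (tdot t t) <= tdot v t])//.
apply: measurableI; first exact: measurable_tpunct.
apply: measurable_bool_set; apply: measurable_fun_ler; first exact: measurable_asqrt.
exact: measurable_tdot.
Qed.

Lemma measurable_tcap0 d a : measurable (tcap0 d a).
Proof.
rewrite (_ : tcap0 d a = tpunct d.+1 `&` [set t | a * Num.sqrt (tdot t t) <= thead t])//.
apply: measurableI; first exact: measurable_tpunct.
apply: measurable_bool_set; apply: measurable_fun_ler; first exact: measurable_asqrt.
exact: measurable_tnth.
Qed.

Lemma leb_tcap d (v : d.+2.-tuple T) a : tdot v v = 1 ->
  leb R d.+2 (tcap v a) = leb R d.+2 (tcap0 d.+1 a).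
Proof.
move=> /rot_axis[f [[mf hf] f1 fiso]].
rewrite -[RHS]hf; last exact: measurable_tcap0.
congr (leb R _ _); apply/seteqP.
by split => t; rewrite /tcap /tcap0 /= fiso f1.
Qed.

Lemma tpunct_sub_tball d : tpunct d `<=` tball R d 1.
Proof. by move=> t /andP[_]; rewrite /tball /= expr1n. Qed.

Lemma leb_sub_fin d (A : set (d.-tuple T)) : measurable A -> A `<=` tpunct d ->
  leb R d A \is a fin_num.
Proof.
move=> mA AP; rewrite ge0_fin_numE//.
have /andP[_] := leb_tball_bounds d; apply: le_lt_trans.
apply: le_leb => //; first exact: measurable_tball.
exact: subset_trans AP (@tpunct_sub_tball d).
Qed.

Lemma tcap0_sub d a : tcap0 d a `<=` tpunct d.+1.
Proof. by move=> t []. Qed.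

Definition capvol d a : R := fine (leb R d.+1 (tcap0 d a)).

Definition punctvol d : R := fine (leb R d (tpunct d)).

Lemma capvolE d a : leb R d.+1 (tcap0 d a) = (capvol d a)%:E.
Proof.
rewrite fineK//; apply: leb_sub_fin; last exact: tcap0_sub.
exact: measurable_tcap0.
Qed.

Lemma punctvolE d : leb R d (tpunct d) = (punctvol d)%:E.
Proof. by rewrite fineK//; apply: leb_sub_fin => //; apply: measurable_tpunct. Qed.

Lemma leb_tcylE d (a b r : R) : a <= b -> 0 < r ->
  leb R d.+1 (tcyl R d a b r) = ((b - a) * r ^+ d * vol d)%:E.
Proof. by move=> ab r0; rewrite leb_tcyl// volE EFinM. Qed.

(** A point of the cone has first coordinate in [[0, 1]] and distance at most [sqrt (1 - a ^+ 2)]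
    from the axis. *)
Lemma capvol_le n a : 0 <= a < 1 -> capvol n a <= Num.sqrt (1 - a ^+ 2) ^+ n * vol n.
Proof.
move=> /andP[a0 a1]; have b0 : 0 < 1 - a ^+ 2 by rewrite subr_gt0 expr_lt1.
rewrite -[_ ^+ n]mul1r -[X in X * _ * _](subr0 1) -lee_fin -capvolE.
rewrite -leb_tcylE ?ler01 ?sqrtr_gt0//.
apply: le_leb; [exact: measurable_tcap0|exact: measurable_tcyl|].
move=> t; rewrite /tcap0 /tcyl /= sqr_sqrtr ?(ltW b0)//.
have h0 := tdot_ge0 (ttail t).
set x : R := thead t; set N := tdot t t.
have NE : N = x ^+ 2 + tdot (ttail t) (ttail t) by exact: tdot_tcons.
set q := tdot (ttail t) _ in h0 NE *.
move=> [/andP[N0 N1] hx].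
have s0 : 0 <= Num.sqrt N by exact: sqrtr_ge0.
have s2 : Num.sqrt N ^+ 2 = N by rewrite sqr_sqrtr// ltW.
have x0 : 0 <= x by apply: le_trans hx; rewrite mulr_ge0.
have ax : a ^+ 2 * N <= x ^+ 2.
  by rewrite -s2 -exprMn; apply: lerXn2r => //; rewrite nnegrE// mulr_ge0.
split; first by rewrite x0/=; nra.
have [xa|ax'] := lerP (a ^+ 2) (x ^+ 2); first by nra.
have aq : a ^+ 2 * q <= (1 - a ^+ 2) * a ^+ 2 by nra.
have a20 : 0 < a ^+ 2 by apply: le_lt_trans ax'; rewrite sqr_ge0.
by rewrite -(ler_pM2l a20) [leRHS]mulrC.
Qed.

(** The cone contains a cylinder over [[a / (1 + e), a]]; its radius is shrunk by [1 + e] so that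
    even its lower end stays in the cone. *)
Lemma capvol_ge n a (e : R) : 0 < a < 1 -> 0 < e ->
  (a - a / (1 + e)) * (Num.sqrt (1 - a ^+ 2) / (1 + e)) ^+ n * vol n <= capvol n a.
Proof.
move=> /andP[a0 a1] e0; have b0 : 0 < 1 - a ^+ 2 by rewrite subr_gt0 expr_lt1// ltW.
have e1 : 0 < 1 + e by lra.
rewrite -lee_fin -capvolE -leb_tcylE; last 2 first.
- by rewrite ler_pdivrMr//; nra.
- by rewrite divr_gt0 ?sqrtr_gt0.
apply: le_leb; [exact: measurable_tcyl|exact: measurable_tcap0|].
move=> t; rewrite /tcap0 /tcyl /= expr_div_n sqr_sqrtr ?(ltW b0)//.
have h0 := tdot_ge0 (ttail t).
set x : R := thead t; set N := tdot t t.
have NE : N = x ^+ 2 + tdot (ttail t) (ttail t) by exact: tdot_tcons.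
set q := tdot (ttail t) _ in h0 NE *.
move=> [/andP[hx xa] hq].
have x0 : 0 < x by apply: lt_le_trans hx; rewrite divr_gt0.
have e2 : 1 <= (1 + e) ^+ 2 by rewrite exprn_ege1//; lra.
have q1 : q <= 1 - a ^+ 2.
  by apply: le_trans hq _; rewrite ler_pdivrMr ?exprn_gt0//; nra.
have N0 : 0 < N by rewrite NE; nra.
split; first by rewrite N0 NE; nra.
rewrite -(@ler_pXn2r _ 2) ?nnegrE ?mulr_ge0 ?sqrtr_ge0 ?(ltW a0) ?(ltW x0)//.
rewrite exprMn sqr_sqrtr ?(ltW N0)// NE.
rewrite ler_pdivrMr// in hx; rewrite ler_pdivlMr ?exprn_gt0// in hq.
have h : a ^+ 2 <= x ^+ 2 * (1 + e) ^+ 2.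
  rewrite -exprMn; apply: lerXn2r => //;
    by rewrite nnegrE ?mulr_ge0 ?(ltW a0) ?(ltW x0) ?(ltW e1).
 have e20 : 0 < (1 + e) ^+ 2 by rewrite exprn_gt0.
rewrite -(ler_pM2r e20); set E := (1 + e) ^+ 2 in hq h e2 e20 *.
have : a ^+ 2 * (q * E) <= x ^+ 2 * E * (1 - a ^+ 2).
  apply: (le_trans (ler_wpM2l (sqr_ge0 a) hq)).
  by rewrite ler_wpM2r// ltW.
by lra.
Qed.

Lemma punctvol_le n : punctvol n.+1 <= 2 * vol n.
Proof.
have -> : 2 * vol n = (1 - (-1)) * 1 ^+ n * vol n by rewrite expr1n opprK mulr1.
rewrite -lee_fin -punctvolE -leb_tcylE; [|lra|lra].
apply: le_leb; [exact: measurable_tpunct|exact: measurable_tcyl|].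
exact: subset_trans (@tpunct_sub_tball _) (@tball_sub_tcyl _).
Qed.

(** The inscribed cylinder over [[e / 2, e]] avoids the origin, and its radius tends to 1 with small
    [e]. *)
Lemma punctvol_ge n (e : R) : 0 < e < 1 ->
  (e - e / 2) * Num.sqrt (1 - e ^+ 2) ^+ n * vol n <= punctvol n.+1.
Proof.
move=> /andP[e0 e1]; have b0 : 0 < 1 - e ^+ 2 by rewrite subr_gt0 expr_lt1// ltW.
rewrite -lee_fin -punctvolE -leb_tcylE; [|lra|by rewrite sqrtr_gt0].
apply: le_leb; [exact: measurable_tcyl|exact: measurable_tpunct|].
move=> t; rewrite /tcyl /tpunct /= sqr_sqrtr ?(ltW b0)// tdot_tcons.
have := tdot_ge0 (ttail t); set x : R := thead t; set q := tdot _ _ => q0.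
by move=> [/andP[h1 h2] h3]; apply/andP; split; nra.
Qed.

Lemma punctvol_gt0 n : 0 < punctvol n.+1.
Proof.
apply: lt_le_trans (@punctvol_ge n (1/2) _); last by lra.
rewrite !mulr_gt0 ?vol_gt0 ?exprn_gt0 ?sqrtr_gt0//; lra.
Qed.

(* The index is one less than the dimension: this is the normalised area of
   the cap [{y | a <= y_0}] of the unit sphere of R^(n+1). *)
Definition capfrac n a := capvol n a / punctvol n.+1.

Definition tup d (x : 'rV[R]_d) : d.-tuple T := [tuple x 0 i | i < d].

Definition rowt d (t : d.-tuple T) : 'rV[R]_d := \row_i tnth t i.

Lemma tdot_tup d (x : 'rV[R]_d) (t : d.-tuple T) : tdot (tup x) t = dotp x (rowt t).
Proof. by apply: eq_bigr => i _; rewrite tnth_mktuple mxE. Qed.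

Lemma tdot_row d (t : d.-tuple T) : tdot t t = dotp (rowt t) (rowt t).
Proof. by apply: eq_bigr => i _; rewrite mxE. Qed.

Lemma tdot_tup2 d (x : 'rV[R]_d) : tdot (tup x) (tup x) = dotp x x.
Proof. by apply: eq_bigr => i _; rewrite tnth_mktuple. Qed.

Lemma coneP d (A : set 'rV[R]_d) (z : 'rV[R]_d) : A `<=` sphere R d ->
  cone A z <-> 0 < dotp z z <= 1 /\ A ((Num.sqrt (dotp z z))^-1 *: z).
Proof.
move=> AS; split=> [[r [x [r0 r1 Ax ->]]]|[/andP[z0 z1] Az]].
  have /sphereP x1 := AS _ Ax.
  rewrite dotpZl dotpZr x1 mulr1 -expr2 sqrtr_sqr gtr0_norm//.
  rewrite exprn_gt0// expr_le1 ?(ltW r0)// r1 scalerA mulVf ?gt_eqF//.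
  by rewrite scale1r.
exists (Num.sqrt (dotp z z)), ((Num.sqrt (dotp z z))^-1 *: z).
split => //; first by rewrite sqrtr_gt0.
  by rewrite -sqrtr1 ler_wsqrtr.
by rewrite scalerA mulfV ?scale1r// gt_eqF// sqrtr_gt0.
Qed.

Lemma dotp_normalize d (z : 'rV[R]_d) : 0 < dotp z z ->
  let y := (Num.sqrt (dotp z z))^-1 *: z in dotp y y = 1.
Proof.
move=> z0 /=; rewrite dotpZl dotpZr mulrA -invfM -expr2 sqr_sqrtr ?ltW//.
by rewrite mulVf// gt_eqF.
Qed.

Lemma surface_measure_cap n (theta : R) (x : 'rV[R]_n.+2) : sphere R n.+2 x ->
  surface_measure (cap theta x) = capfrac n.+1 (cos theta).
Proof.
move=> /sphereP x1; rewrite /surface_measure /capfrac /capvol /punctvol.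
congr (fine _ / fine _).
  rewrite -(@leb_tcap _ (tup x)) ?tdot_tup2// /lebesgue_rV lebE.
  congr (lebesgue_tuple _); apply/seteqP; split => t;
    rewrite /tcap /= tdot_tup tdot_row -/(rowt t).
  - move=> /coneP[|h [hs]]; first by move=> y [].
    rewrite dotpZr mulrC ler_pdivlMr ?sqrtr_gt0; last by case/andP: h.
    by [].
  - move=> [h hc]; apply/coneP; first by move=> y [].
    have h0 : 0 < dotp (rowt t) (rowt t) by case/andP: h.
    split => //; split; first by apply/sphereP; exact: dotp_normalize.
    by rewrite dotpZr mulrC ler_pdivlMr ?sqrtr_gt0.
rewrite /lebesgue_rV lebE; congr (lebesgue_tuple _); apply/seteqP; split => t;
  rewrite /tpunct /= tdot_row -/(rowt t).
- by move=> /coneP[].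
- move=> h; apply/coneP => //; split => //; apply/sphereP; apply: dotp_normalize.
  by case/andP: h.
Qed.

End CapVolume.
Arguments tcap0 : clear implicits.
Arguments tpunct : clear implicits.
Arguments vol : clear implicits.

(** * Discretisation of the sphere *)

Section Discretize.
Variable R : realType.
Local Notation T := (measurableTypeR R).

(** Continuity of the measure from above; the mesh of the discretisation will thus cost only a
    factor [1 + e]. *)
Lemma capvol_right_continuous n (a e : R) : 0 < e -> 0 < capvol n a ->
  exists2 eta, 0 < eta & capvol n (a - eta) <= (1 + e) * capvol n a.
Proof.
move=> e0 c0; pose F k := tcap0 R n (a - k.+1%:R^-1).
have mF k : measurable (F k) by exact: measurable_tcap0.
have FI : \bigcap_k F k = tcap0 R n a.
  apply/seteqP; split => t.
    move=> h; split; first by have [] := h 0%N I.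
    apply/ler_addgt0Pr => r r0; have [/andP[t0 t1] _] := h 0%N I.
    have [k] := ltr_add_invr r0; rewrite add0r => kr.
    have [_] := h k I.
    have s1 : Num.sqrt (tdot t t) <= 1 by rewrite -sqrtr1 ler_wsqrtr.
    have s0 : 0 <= Num.sqrt (tdot t t) by exact: sqrtr_ge0.
    have k0 : 0 < k.+1%:R^-1 :> R by rewrite invr_gt0.
    set x : R := thead t; set q := Num.sqrt _ in s0 s1 *; set u := _^-1 in kr k0 *.
    by move=> hk; nra.
  move=> [h1 h2] k _; split => //; apply: le_trans h2.
  by rewrite ler_wpM2r ?sqrtr_ge0// gerBl invr_ge0.
have noninc : {homo F : i j / (i <= j)%N >-> (j <= i)%O}.
  move=> i j ij; apply/subsetPset => t [h1 h2]; split => //; apply: le_trans h2.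
  rewrite ler_wpM2r ?sqrtr_ge0// lerD2l lerN2 lef_pV2 ?posrE ?ltr0n//.
  by rewrite ler_nat ltnS.
have cv : (leb R n.+1 \o F) k @[k --> \oo] --> leb R n.+1 (\bigcap_k F k).
  apply: nonincreasing_cvg_mu => //; last by rewrite FI; exact: measurable_tcap0.
  by have := ltry (capvol n (a - 1%:R^-1)); rewrite -capvolE.
rewrite FI capvolE in cv.
have {}cv : capvol n (a - k.+1%:R^-1) @[k --> \oo] --> capvol n a by exact: fine_cvg cv.
have lt : capvol n a < (1 + e) * capvol n a by nra.
have [k hk] := filter_ex (cvgr_lt _ cv _ lt).
by exists k.+1%:R^-1; [rewrite invr_gt0|exact: ltW].
Qed.

Lemma dotp_continuous_l d (y : 'rV[R]_d) : continuous (fun z : 'rV[R]_d => dotp y z).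
Proof.
rewrite /dotp => z; apply: cvg_big; [exact: add_continuous|exact: nbhs_filter|move=> i _].
apply: (@continuousM _ _ (fun=> y 0 i) (fun z : 'rV[R]_d => z 0 i)).
  exact: cst_continuous.
exact: coord_continuous.
Qed.

Lemma dotp_continuous d : continuous (fun z : 'rV[R]_d => dotp z z).
Proof.
rewrite /dotp => z; apply: cvg_big; [exact: add_continuous|exact: nbhs_filter|move=> i _].
by apply: (@continuousM _ _ (fun z : 'rV[R]_d => z 0 i) (fun z => z 0 i));
  exact: coord_continuous.
Qed.

Lemma sphere_compact d : compact (sphere R d).
Proof.
have -> : sphere R d = (fun z => dotp z z) @^-1` [set 1].
  by apply/seteqP; split => z /sphereP.
apply: (@subclosed_compact _ _ [set v : 'rV[R]_d | forall i, `[-1, 1]%classic (v ord0 i)]).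
- by apply: (continuous_closedP _).1; [exact: dotp_continuous|exact: closed_eq].
- exact: (@rV_compact R^o d (fun=> `[-1, 1]%classic)
    (fun=> @segment_compact R (-1) 1)).
move=> z /= z1 i; rewrite /= in_itv/= -ler_norml -(@expr_le1 _ 2)//.
rewrite real_normK ?num_real// -z1 /dotp (bigD1 i)//= -expr2 lerDl.
by apply: sumr_ge0 => j _; rewrite -expr2 sqr_ge0.
Qed.

Lemma sphere_net d (delta : R) : 0 < delta -> exists s : seq 'rV[R]_d,
  (forall y, y \in s -> dotp y y = 1) /\
  (forall z, dotp z z = 1 -> exists2 y, y \in s & 1 - delta < dotp y z).
Proof.
move=> delta0; have := @sphere_compact d; rewrite compact_cover.
move=> /(_ 'rV[R]_d (sphere R d) (fun y => [set z | 1 - delta < dotp y z])).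
case=> [y _|z zS|D DS cov].
- rewrite (_ : [set _ | _] = (fun z => dotp y z) @^-1` [set x | 1 - delta < x])//.
  by apply: open_comp => [z _|]; [exact: dotp_continuous_l|exact: open_gt].
- by exists z => //=; move/sphereP: zS => ->; rewrite ltrBlDr ltrDl.
exists (enum_fset D); split.
  by move=> y yD; apply/sphereP; have := DS _ yD; rewrite inE.
by move=> z /sphereP /cov[y yD h]; exists y.
Qed.

Lemma unit_dotp_near d (v y z : 'rV[R]_d) (eta : R) : 0 < eta ->
  dotp v v = 1 -> dotp y y = 1 -> dotp z z = 1 ->
  1 - eta ^+ 2 / 2 < dotp y z -> dotp v y - eta <= dotp v z.
Proof.
move=> eta0 v1 y1 z1 yz.
have h : dotp (y - z) v ^+ 2 <= eta ^+ 2.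
  apply: (le_trans (dotp_unit_sqr_le _ v1)).
  rewrite -scaleN1r !(dotpDl, dotpDr, dotpZl, dotpZr) y1 z1 (dotpC z y).
  lra.
have : dotp (y - z) v <= eta.
  apply: le_trans (ler_norm _) _.
  by rewrite -(@ler_pXn2r _ 2) ?nnegrE ?(ltW eta0)// real_normK ?num_real.
by rewrite -scaleN1r dotpDl dotpZl (dotpC y) (dotpC z) => ?; lra.
Qed.

(** The weights are the normalised volumes of disjoint cones, each close to one point of a finite
    net; hence cells represented in a cap fill at most a slightly larger cap. *)
Lemma discretize n (eta : R) : 0 < eta ->
  exists N (y : 'I_N -> 'rV[R]_n.+2) (p : 'I_N -> R),
  [/\ forall i, dotp (y i) (y i) = 1, forall i, 0 <= p i, \sum_i p i = 1 &
   forall v a, dotp v v = 1 ->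
    \sum_(i | a <= dotp v (y i)) p i <= capfrac n.+1 (a - eta)].
Proof.
move=> eta0; set delta := eta ^+ 2 / 2.
have delta0 : 0 < delta by rewrite divr_gt0 ?exprn_gt0.
have [s [s1 scov]] := @sphere_net n.+2 delta delta0.
pose y k : 'rV[R]_n.+2 := nth 0 s k.
(* Cones over open caps about the net points; [seqDU] makes them disjoint without changing their
   union. *)
pose C k := [set t : n.+2.-tuple T | 0 < tdot t t <= 1 /\
  (1 - delta) * Num.sqrt (tdot t t) < tdot (tup (y k)) t].
have mC k : measurable (C k).
  rewrite (_ : C k = tpunct R n.+2 `&`
    [set t | (1 - delta) * Num.sqrt (tdot t t) < tdot (tup (y k)) t])//.
  apply: measurableI; first exact: measurable_tpunct.
  apply: measurable_bool_set; apply: measurable_fun_ltr; first exact: measurable_asqrt.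
  exact: measurable_tdot.
have CE k t : C k t <-> 0 < tdot t t <= 1 /\
    1 - delta < dotp (y k) ((Num.sqrt (dotp (rowt t) (rowt t)))^-1 *: rowt t).
  rewrite /C /= tdot_tup tdot_row dotpZr mulrC.
  by split=> -[/andP[t0 t1]]; rewrite [_^-1 * _]mulrC ltr_pdivlMr ?sqrtr_gt0// mulrC t0 t1.
pose N := size s; pose D (i : 'I_N) := seqDU C i.
have mD i : measurable (D i) by exact: seqDU_measurable.
have tD : trivIset setT D.
  apply/trivIsetP => i j _ _ ij.
  by have /trivIsetP/(_ i j) := trivIset_seqDU C; apply.
have DC i : D i `<=` C i by exact: subset_seqDU.
have DP i : D i `<=` tpunct R n.+2 by move=> t /DC; rewrite /C /= => -[].
have y1 (i : 'I_N) : dotp (y i) (y i) = 1 by apply: s1; rewrite mem_nth.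
pose p i := fine (leb R n.+2 (D i)) / punctvol R n.+2.
have DE (i : 'I_N) : leb R n.+2 (D i) = (fine (leb R n.+2 (D i)))%:E.
  by rewrite fineK//; exact: leb_sub_fin.
have psum (P : pred 'I_N) : (\sum_(i | P i) p i =
    fine (leb R n.+2 (\big[setU/set0]_(i | P i) D i)) / punctvol R n.+2)%R.
  have -> : (leb R n.+2 (\big[setU/set0]_(i | P i) D i) =
      \sum_(i | P i) leb R n.+2 (D i))%E by exact: measure_bigsetU_ord.
  rewrite -mulr_suml; congr (_ / _).
  by under [in RHS]eq_bigr => i _ do rewrite DE; rewrite sumEFin.
have P0 : 0 < punctvol R n.+2 by exact: punctvol_gt0.
exists N, (fun i => y i), p; split => //.
- by move=> i; rewrite divr_ge0 ?fine_ge0// ltW.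
- rewrite psum -bigsetU_seqDU -bigcup_mkord.
  rewrite (_ : \bigcup_(i < N) C i = tpunct R n.+2) ?divff ?gt_eqF//.
  apply/seteqP; split => t; first by move=> [k _ []].
  move=> /[dup] tP /andP[t0 t1].
  have [|u us hu] := scov ((Num.sqrt (dotp (rowt t) (rowt t)))^-1 *: rowt t).
    by apply: dotp_normalize; rewrite -tdot_row.
  exists (index u s); first by rewrite /= index_mem.
  by apply/CE; rewrite /y nth_index.
- move=> v a v1; rewrite psum /capfrac ler_pM2r ?invr_gt0//.
  rewrite /capvol -(@leb_tcap _ _ (tup v)) ?tdot_tup2//.
  have sub : \big[setU/set0]_(i < N | a <= dotp v (y i)) D i `<=` tcap (tup v) (a - eta).
    elim/big_ind : _ => [//|A B hA hB t [/hA|/hB]//|i ai t /DC/CE[tP ht]].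
    split => //; move/andP: tP => [t0 t1]; rewrite tdot_row in t0.
    rewrite tdot_tup tdot_row.
    have z1 := dotp_normalize t0.
    have := unit_dotp_near eta0 v1 (y1 i) z1 ht.
    rewrite dotpZr [_^-1 * _]mulrC ler_pdivlMr ?sqrtr_gt0// => h.
    by apply: le_trans h; rewrite ler_wpM2r ?sqrtr_ge0// lerD2r.
  have mB : measurable (\big[setU/set0]_(i < N | a <= dotp v (y i)) D i).
    by apply: bigsetU_measurable => i _.
  apply: fine_le.
  + apply: leb_sub_fin => //; apply: subset_trans sub _; by move=> t [].
  + by apply: leb_sub_fin; [exact: measurable_tcap|move=> t []].
  + by apply: le_leb => //; exact: measurable_tcap.
Qed.

Lemma spherical_code_bounded d (theta : R) : cos theta < 1 ->
  exists N, forall X : {fset 'rV[R]_d}, spherical_code theta X -> (#|` X| <= N)%N.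
Proof.
move=> c1; pose delta := (1 - cos theta) / 8.
have cm1 : -1 <= cos theta by exact: cos_geN1.
have d0 : 0 < delta by rewrite /delta; lra.
have [s [s1 scov]] := @sphere_net d delta d0.
exists (size s) => X [Xs Xc].
pose f x := nth 0 s (find (fun y => 1 - delta < dotp y x) s).
have fP x : x \in X -> 1 - delta < dotp (f x) x /\ f x \in s.
  move=> /Xs /sphereP /scov [y ys hy].
  have hs : has (fun y => 1 - delta < dotp y x) s by apply/hasP; exists y.
  split; first exact: (nth_find 0 hs).
  by rewrite mem_nth// -has_find.
have inj : {in enum_fset X &, injective f}.
  move=> x x' xX x'X ff'; apply/eqP; rewrite -[_ == _]negbK; apply/negP => xx'.
  have [hx fs] := fP x xX; have [hx' _] := fP x' x'X; rewrite -ff' in hx'.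
  have /sphereP x1 := Xs _ xX; have /sphereP x'1 := Xs _ x'X.
  have := dotp_unit_sqr_le (x + x') (s1 _ fs).
  rewrite !(dotpDl, dotpDr) x1 x'1 (dotpC x' x) (dotpC x (f x)) (dotpC x' (f x)).
  have := Xc _ _ xX x'X xx'.
  move: hx hx'; rewrite /delta.
  set u := dotp (f x) x; set u' := dotp (f x) x'; set q := dotp x x'.
  set c := cos theta in cm1 c1 *; move=> h1 h2 h3.
  suff : (2 * (1 - (1 - c) / 8)) ^+ 2 <= (u + u') ^+ 2 by nra.
  by rewrite ler_pXn2r ?nnegrE//; lra.
have ui : uniq (map f (enum_fset X)) by rewrite map_inj_in_uniq// fset_uniq.
have sub : {subset map f (enum_fset X) <= s}.
  by move=> y /mapP[x xX ->]; exact: (fP x xX).2.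
by have := uniq_leq_size ui sub; rewrite size_map.
Qed.

(** Sizes are bounded, so a maximum exists and [xget] does not return its default. *)
Lemma max_code_size_ge d (theta : R) (X : {fset 'rV[R]_d}) : cos theta < 1 ->
  spherical_code theta X -> (#|` X| <= max_code_size d theta)%N.
Proof.
move=> c1 Xc; have [N hN] := @spherical_code_bounded d theta c1.
pose P (k : nat) := `[< exists Y : {fset 'rV[R]_d}, spherical_code theta Y /\ #|` Y| = k >].
have exP : exists k, P k by exists #|` X|; apply/asboolP; exists X.
have ubP k : P k -> (k <= N)%N by move=> /asboolP[Y [Yc <-]]; exact: hN.
case: (ex_maxnP exP ubP) => m /asboolP mP mmax.
pose Q := [set k : nat |
    (exists X : {fset 'rV[R]_d}, spherical_code theta X /\ #|` X| = k) /\
    (forall X : {fset 'rV[R]_d}, spherical_code theta X -> (#|` X| <= k)%N)].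
have : Q (max_code_size d theta).
  apply: xgetPex; exists m; split => // Y Yc; apply: mmax.
  by apply/asboolP; exists Y.
by move=> [_]; apply.
Qed.

End Discretize.

(** * Asymptotics *)

Section MomentGenerating.
Variable R : realType.

Lemma capvol_anti n (a b : R) : a <= b -> capvol n b <= capvol n a.
Proof.
move=> ab; rewrite -lee_fin -!capvolE.
apply: le_leb; [exact: measurable_tcap0|exact: measurable_tcap0|].
move=> t [h1 h2]; split => //; apply: le_trans h2.
by rewrite ler_wpM2r ?sqrtr_ge0.
Qed.

Lemma capfrac_anti n (a b : R) : a <= b -> capfrac n b <= capfrac n a.
Proof.
by move=> ab; rewrite ler_pM2r ?invr_gt0 ?punctvol_gt0//; apply: capvol_anti.
Qed.

Lemma capfrac_le n (a e : R) : 0 <= a < 1 -> 0 < e < 1 ->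
  capfrac n a <= Num.sqrt (1 - a ^+ 2) ^+ n / (e / 2 * Num.sqrt (1 - e ^+ 2) ^+ n).
Proof.
move=> a01 /andP[e0 e1].
have e2 : 0 < Num.sqrt (1 - e ^+ 2) by rewrite sqrtr_gt0 subr_gt0 expr_lt1// ltW.
have q0 : 0 < e / 2 * Num.sqrt (1 - e ^+ 2) ^+ n by rewrite mulr_gt0 ?exprn_gt0// divr_gt0.
rewrite /capfrac ler_pdivrMr ?punctvol_gt0// mulrAC ler_pdivlMr//.
apply: (le_trans (ler_wpM2r (ltW q0) (capvol_le n a01))).
rewrite -[leLHS]mulrA ler_wpM2l ?exprn_ge0 ?sqrtr_ge0// mulrC.
have := @punctvol_ge R n e; rewrite e0 e1 => /(_ isT).
by rewrite (_ : e - e / 2 = e / 2)//; field.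
Qed.

Lemma capfrac_ge n (a e : R) : 0 < a < 1 -> 0 < e ->
  (a - a / (1 + e)) / 2 * (Num.sqrt (1 - a ^+ 2) / (1 + e)) ^+ n <= capfrac n a.
Proof.
move=> a01 e0; rewrite /capfrac ler_pdivlMr ?punctvol_gt0//.
apply: le_trans (capvol_ge n a01 e0).
move: a01 => /andP[a0 a1].
have ae : 0 <= a - a / (1 + e) by rewrite subr_ge0 ler_pdivrMr; nra.
set q := (_ / (1 + e)) ^+ n.
have q0 : 0 <= q by rewrite exprn_ge0// divr_ge0 ?sqrtr_ge0//; lra.
apply: (@le_trans _ _ ((a - a / (1 + e)) / 2 * q * (2 * vol R n))).
  by rewrite ler_wpM2l ?punctvol_le// !mulr_ge0.
by rewrite le_eqVlt; apply/orP; left; apply/eqP; field; lra.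
Qed.

(** Tangent at [c] to the concave function [ln (1 - x ^+ 2) / 2]. Its slope dictates the exponent
    [t] of [mgf_le], for which the maximum of [expR (t * x) * Num.sqrt (1 - x ^+ 2) ^+ m] is at
    [x = c]. *)
Lemma sqrt_tangent (c x : R) : 0 < c < 1 ->
  Num.sqrt (1 - x ^+ 2) <= Num.sqrt (1 - c ^+ 2) * expR (c / (1 - c ^+ 2) * (c - x)).
Proof.
move=> /andP[c0 c1]; have s0 : 0 < 1 - c ^+ 2 by rewrite subr_gt0 expr_lt1// ltW.
set k := c / _.
have -> : expR (k * (c - x)) = Num.sqrt (expR (2 * k * (c - x))).
  by rewrite -mulrA mulr_natl mulr2n expRD -expr2 sqrtr_sqr ger0_norm ?expR_ge0.
rewrite -sqrtrM ?(ltW s0)//; apply: ler_wsqrtr.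
apply: le_trans (ler_wpM2l (ltW s0) (expR_ge1Dx _)).
rewrite (_ : (1 - c ^+ 2) * (1 + 2 * k * (c - x)) = 1 + c ^+ 2 - 2 * c * x); last first.
  by rewrite /k; field; lra.
by have := sqr_ge0 (c - x); nra.
Qed.

Lemma sqrt_expr_tangent (c x : R) m : 0 < c < 1 ->
  expR (m%:R * (c / (1 - c ^+ 2)) * x) * Num.sqrt (1 - x ^+ 2) ^+ m <=
  expR (m%:R * (c / (1 - c ^+ 2)) * c) * Num.sqrt (1 - c ^+ 2) ^+ m.
Proof.
move=> c01; set k := c / _.
have h : Num.sqrt (1 - x ^+ 2) ^+ m <= (Num.sqrt (1 - c ^+ 2) * expR (k * (c - x))) ^+ m.
  apply: lerXn2r; rewrite ?nnegrE ?mulr_ge0 ?sqrtr_ge0 ?expR_ge0//.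
  exact: sqrt_tangent.
apply: (le_trans (ler_wpM2l (expR_ge0 _) h)).
rewrite exprMn -expRM_natl mulrCA -expRD mulrC ler_wpM2r ?exprn_ge0 ?sqrtr_ge0//.
by rewrite ler_expR; lra.
Qed.

(** A layer-cake bound with [K] layers of height [1 / K]; the term [1] covers negative [s]. *)
Lemma expR_layers (t s : R) K : 0 <= t -> s <= 1 -> (0 < K)%N ->
  expR (t * s) <= 1 + \sum_(k < K) expR (t * (k.+1%:R / K%:R)) * (k%:R / K%:R <= s)%R%:R.
Proof.
move=> t0 s1 K0; have K0' : 0 < K%:R :> R by rewrite ltr0n.
have sum0 : 0 <= \sum_(k < K) expR (t * (k.+1%:R / K%:R)) * (k%:R / K%:R <= s)%R%:R.
  by apply: sumr_ge0 => k _; rewrite mulr_ge0 ?expR_ge0.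
have [s0|s0] := ltrP s 0.
  apply: (@le_trans _ _ 1); last by rewrite lerDl.
  by rewrite -[leRHS]expR0 ler_expR mulr_ge0_le0// ltW.
suff [k [h1 h2]] : exists k : 'I_K, k%:R / K%:R <= s /\ s <= k.+1%:R / K%:R.
  apply: (@le_trans _ _ (\sum_(k < K) expR (t * (k.+1%:R / K%:R)) *
    (k%:R / K%:R <= s)%R%:R)); last by rewrite lerDr.
  rewrite (bigD1 k)//= h1 mulr1; apply: ler_wpDr.
    by apply: sumr_ge0 => i _; rewrite mulr_ge0 ?expR_ge0.
  by rewrite ler_expR ler_wpM2l.
have sK0 : 0 <= s * K%:R by rewrite mulr_ge0// ltW.
have /andP[q1 q2] := truncn_itv sK0; set q := Num.truncn _ in q1 q2.
have [qK|Kq] := ltnP q K.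
  exists (Ordinal qK) => /=; rewrite ler_pdivrMr// ler_pdivlMr//; split => //.
  exact: ltW.
have KK : (K.-1 < K)%N by rewrite prednK.
exists (Ordinal KK) => /=; rewrite ler_pdivrMr// ler_pdivlMr// prednK//; split.
  apply: le_trans q1; rewrite ler_nat; apply: leq_trans Kq; exact: leq_pred.
by rewrite ler_piMl// ltW.
Qed.

(** Laplace's method: each of the [K] layers is at most the value at the maximiser [c]. One layer is
    lost in [expR_layers] and one in the shifted hypothesis on caps, whence [2 / K]. *)
Lemma mgf_le d (V : finType) (y : V -> 'rV[R]_d) (p : V -> R) (c G : R) m K :
  (forall i, dotp (y i) (y i) = 1) -> (forall i, 0 <= p i) -> \sum_i p i = 1 ->
  0 < c < 1 -> (0 < K)%N -> 1 <= G ->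
  (forall v k, dotp v v = 1 -> (k < K)%N -> \sum_(i | k.+1%:R / K%:R <= dotp v (y i)) p i <=
     G * Num.sqrt (1 - (k%:R / K%:R) ^+ 2) ^+ m) ->
  let t := m%:R * (c / (1 - c ^+ 2)) in
  forall v, dotp v v <= 1 ->
  \sum_i p i * expR (t * dotp v (y i)) <=
  K.+1%:R * G * expR (t * (2 / K%:R)) * Num.sqrt (1 - c ^+ 2) ^+ m * expR (t * c).
Proof.
move=> y1 p0 p1 c01 K0 G1 hp t v v1.
have K0' : 0 < K%:R :> R by rewrite ltr0n.
have G0 : 0 < G by apply: lt_le_trans G1.
have t0 : 0 <= t.
  case/andP: c01 => c0 c1; rewrite mulr_ge0// divr_ge0 ?(ltW c0)// subr_ge0.
  by rewrite expr_le1// ltW.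
pose W := G * (expR (t * (2 / K%:R)) * (expR (t * c) * Num.sqrt (1 - c ^+ 2) ^+ m)).
have e2 : 1 <= expR (t * (2 / K%:R)) by rewrite -[leLHS]expR0 ler_expR mulr_ge0// divr_ge0// ltW.
have tan x := sqrt_expr_tangent x m c01; rewrite -/t in tan.
have one : 1 <= expR (t * c) * Num.sqrt (1 - c ^+ 2) ^+ m.
  by apply: le_trans (tan 0); rewrite mulr0 expR0 expr0n/= subr0 sqrtr1 expr1n mulr1.
have W1 : 1 <= W by rewrite /W mulr_ege1// mulr_ege1.
have layer (k : 'I_K) :
    \sum_(i | k%:R / K%:R <= dotp v (y i)) p i * expR (t * (k.+1%:R / K%:R)) <= W.
  rewrite -mulr_suml mulrC.
  have [k0|k0] := posnP k.
    apply: (@le_trans _ _ (expR (t * (k.+1%:R / K%:R)))).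
      rewrite -[leRHS]mulr1 ler_wpM2l ?expR_ge0// -[leRHS]p1.
      by rewrite [leRHS](bigID (fun i => k%:R / K%:R <= dotp v (y i)))/= lerDl sumr_ge0.
    apply: (@le_trans _ _ (expR (t * (2 / K%:R)))).
      by rewrite ler_expR ler_wpM2l// ler_pM2r ?invr_gt0// k0 ler_nat.
    rewrite -[leLHS]mul1r ler_pM// ?expR_ge0//.
    by rewrite -[leLHS]mulr1 ler_wpM2l ?expR_ge0.
  (* At a positive height, normalising [v] only enlarges the cap, so the hypothesis for unit vectors
     applies at [k']. *)
  pose k' := k.-1; have kE : k = k'.+1 :> nat by rewrite prednK.
  have [/existsP[j hj]|nex] := boolP [exists j, k%:R / K%:R <= dotp v (y j)]; last first.
    rewrite big_pred0 ?mulr0 ?(le_trans ler01 W1)// => i.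
    by apply: contraNF nex => h; apply/existsP; exists i.
  have kK : 0 < k%:R / K%:R :> R by rewrite divr_gt0// ltr0n.
  have v0 : 0 < dotp v v.
    rewrite lt_neqAle dotp_ge0 andbT; apply/eqP => v0.
    have := dotp_unit_sqr_le v (y1 j); rewrite -v0; apply/negP; rewrite -ltNge.
    by rewrite exprn_gt0// (lt_le_trans kK).
  set sv := Num.sqrt (dotp v v).
  have sv0 : 0 < sv by rewrite sqrtr_gt0.
  have sv1 : sv <= 1 by rewrite -sqrtr1 ler_wsqrtr.
  have P1 : \sum_(i | k%:R / K%:R <= dotp v (y i)) p i <=
      G * Num.sqrt (1 - (k'%:R / K%:R) ^+ 2) ^+ m.
    have k'K : (k' < K)%N by rewrite (leq_ltn_trans _ (ltn_ord k))// leq_pred.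
    have u1 : dotp (sv^-1 *: v) (sv^-1 *: v) = 1 by exact: (dotp_normalize v0).
    apply: le_trans (hp _ _ u1 k'K).
    rewrite [leRHS](bigID (fun i => k%:R / K%:R <= dotp v (y i)))/=.
    rewrite -[leLHS]addr0 lerD ?sumr_ge0// le_eqVlt; apply/orP; left; apply/eqP.
    apply: eq_bigl => i; rewrite andbC; have [h|//] := boolP (k%:R / K%:R <= _).
    rewrite dotpZl -kE /=; apply/esym; apply: (le_trans h).
    by rewrite mulrC ler_pdivlMr// ler_piMr// (le_trans (ltW kK) h).
  apply: (le_trans (ler_wpM2l (expR_ge0 _) P1)).
  rewrite mulrCA ler_wpM2l ?(ltW G0)//.
  have := ler_wpM2l (ltW (lt_le_trans ltr01 e2)) (tan (k'%:R / K%:R)).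
  apply: le_trans; rewrite [leRHS]mulrA ler_wpM2r ?exprn_ge0 ?sqrtr_ge0//.
  rewrite -expRD ler_expR -mulrDr.
  by rewrite ler_wpM2l// -mulrDl ler_pM2r ?invr_gt0// kE -natrD ler_nat.
apply: (@le_trans _ _ (\sum_i p i * (1 + \sum_(k < K) expR (t * (k.+1%:R / K%:R)) *
    (k%:R / K%:R <= dotp v (y i))%R%:R))).
  apply: ler_sum => i _; rewrite ler_wpM2l//; apply: expR_layers => //.
  have := dotp_unit_sqr_le v (y1 i); nra.
under eq_bigr => i _ do rewrite mulrDr mulr1 mulr_sumr.
rewrite big_split/= p1 exchange_big/=.
apply: (@le_trans _ _ (W + \sum_(k < K) W)).
  apply: lerD => //; apply: ler_sum => k _; apply: le_trans (layer k).
  rewrite [leRHS]big_mkcond/=; apply: ler_sum => i _.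
  by case: ifP => _; rewrite ?mulr1 ?mulr0 ?mulr0.
rewrite sumr_const card_ord -mulrS -mulr_natl le_eqVlt; apply/orP; left; apply/eqP.
by rewrite /W; ring.
Qed.

Lemma exp_dominates (r C : R) : 0 < r ->
  \forall m \near \oo, C * (1 + m%:R) <= expR (r * m%:R).
Proof.
move=> r0; near=> m.
have m1 : 1 <= m%:R :> R by near: m; exact: nbhs_infty_ger.
have mC : 8 * `|C| / r ^+ 2 <= m%:R by near: m; exact: nbhs_infty_ger.
have -> : expR (r * m%:R) = expR (r * m%:R / 2) ^+ 2.
  by rewrite expr2 -expRD; congr expR; field.
have h := expR_ge1Dx (r * m%:R / 2).
have rm : 0 <= r * m%:R / 2 by rewrite divr_ge0 ?mulr_ge0 ?(ltW r0).
apply: (@le_trans _ _ ((r * m%:R / 2) ^+ 2)); last by nra.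
rewrite ler_pdivrMr ?exprn_gt0// in mC.
have := ler_norm C; have := normr_ge0 C; move: mC; set D := `|C|; set x := m%:R in m1 *.
move=> h1 h2 h3.
have : (8 * D) * x <= x * r ^+ 2 * x by rewrite ler_wpM2r//; lra.
by nra.
Unshelve. all: by end_near. Qed.

End MomentGenerating.

(** * Choice of the parameters *)

Lemma asymptotic_arith (R : realType) (L e' eps x AF : R) : 0 < L -> 0 < e' ->
  e' <= 1 -> 0 < eps -> 10 * eps <= 1 -> 10 * eps * (L + 1) = e' * L ->
  12 <= x * e' -> (L - 5 * eps) * x <= AF * (1 + 4 * eps) ->
  (1 - e') * L * (x + 1) <= AF.
Proof.
move=> L0 e'0 e'1 eps0 eps1 epsE xe main.
have x0 : 0 <= x by rewrite -(pmulr_lge0 _ e'0); lra.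
rewrite -(@ler_pM2r _ (1 + 4 * eps)); last by lra.
apply: le_trans main.
have h1 : (1 - e') * (1 + 4 * eps) <= 1 - e' + 4 * eps by nra.
have h2 : (1 - e' + 4 * eps) * (L * (x + 1)) <= (L - 5 * eps) * x.
  have p1 : L * 12 <= L * (x * e') by rewrite ler_wpM2l// ltW.
  have p2 : 10 * eps * (L + 1) * x = e' * L * x by rewrite epsE.
  have p3 : L * eps <= L by rewrite ler_piMr ?(ltW L0)//; lra.
  have p4 : 0 <= L * e' by rewrite mulr_ge0 ?(ltW L0) ?(ltW e'0).
  have p5 : 0 <= eps * x by rewrite mulr_ge0 ?(ltW eps0).
  have p6 : 0 <= L * eps * x by rewrite -mulrA mulr_ge0 ?(ltW L0).
  by move: p1 p2 p3 p4 p5 p6 L0; clear; lra.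
apply: le_trans h2.
have Lx : 0 <= L * (x + 1) by rewrite mulr_ge0 ?(ltW L0)// addr_ge0.
by have := ler_wpM2r Lx h1; clear; lra.
Qed.

Section Asymptotics.
Variables (R : realType) (theta : R).
Hypothesis cos01 : 0 < cos theta < 1.
Let a := cos theta.
Let c := Num.sqrt a.
Let kap := c / (1 - c ^+ 2).

Let c2 : c ^+ 2 = a.
Proof. by rewrite sqr_sqrtr// ltW//; case/andP: cos01. Qed.

Let c01 : 0 < c < 1.
Proof.
case/andP: cos01 => a0 a1.
by rewrite sqrtr_gt0 a0/= -sqrtr1 ltr_sqrt.
Qed.

Lemma code_of_set d (V : finType) (y : V -> 'rV[R]_d) (I : {set V}) :
  (forall i, dotp (y i) (y i) = 1) ->
  {in I &, forall i j, i != j -> dotp (y i) (y j) <= a} ->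
  (#|I| <= max_code_size d theta)%N.
Proof.
move=> y1 hI; case/andP: cos01 => a0 a1.
pose X := [fset y i | i in I]%fset.
have inj : {in I &, injective y}.
  move=> i j iI jI yy; apply/eqP; apply/negPn/negP => ij.
  by have := hI _ _ iI jI ij; rewrite yy y1; apply/negP; rewrite -ltNge.
have -> : #|I| = #|` X|.
  rewrite card_in_imfset/=; last by move=> i j; apply: inj.
  by rewrite cardE.
apply: max_code_size_ge => //; split.
  by move=> x /imfsetP[i iI ->]; apply/sphereP.
move=> x x' /imfsetP[i iI ->] /imfsetP[j jI ->] xx'; apply: hI => //.
by apply: contraNneq xx' => ->.
Qed.

(** The bound in a fixed dimension [n.+2], with the discretisation eliminated. *)
Lemma max_code_size_finite_bound n (K M : nat) (G B E del y0 eps : R) :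
  let m := n.+1 in let t := m%:R * kap in
  (0 < K)%N -> 1 <= G -> 0 < eps -> 0 < capfrac m a ->
  (forall x, 0 <= x < 1 -> capfrac m x <= G * Num.sqrt (1 - x ^+ 2) ^+ m) ->
  K.+1%:R * G * expR (t * (2 / K%:R)) * Num.sqrt (1 - c ^+ 2) ^+ m <= B ->
  0 < E -> 0 <= del -> (0 < M)%N ->
  E^-1 + expR (2 * t * M%:R) / E ^+ (M ^ 2) < del ^+ (M ^ 2) ->
  0 <= y0 -> expR (- y0) * (1 + y0) <= expR (- E^-1) -> del * (1 + y0) < 1 ->
  expR (- y0) * (1 + y0) / (B * E ^+ 2) <=
  (max_code_size n.+2 theta)%:R * (1 + expR (- y0) / (1 - del * (1 + y0)) *
     ((1 + eps) * capfrac m a / (B * E ^+ 2))).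
Proof.
move=> m t K0 G1 eps0 F0 hG hB E0 del0 M0 hdel y00 hy dy.
have K0' : 0 < K%:R :> R by rewrite ltr0n.
have P0 : 0 < punctvol R m.+1 by exact: punctvol_gt0.
have V0 : 0 < capvol m a by move: F0; rewrite /capfrac pmulr_lgt0// invr_gt0.
have [eta0 e00 heta] := capvol_right_continuous eps0 V0.
(* The mesh must keep the neighbourhood mass within [1 + eps] of the cap and stay below one layer of
   [mgf_le]. *)
pose eta := Num.min eta0 K%:R^-1.
have eta_gt0 : 0 < eta by rewrite lt_min e00 invr_gt0.
have [N [y [p [y1 p0 p1 hp]]]] := discretize n eta_gt0.
have B0 : 0 < B.
  apply: lt_le_trans hB; case/andP: c01 => c0 c1.
  rewrite !mulr_gt0 ?expR_gt0 ?exprn_gt0 ?(lt_le_trans ltr01 G1)//.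
  by rewrite sqrtr_gt0 subr_gt0 expr_lt1// ltW.
have hp' v k : dotp v v = 1 -> (k < K)%N ->
    \sum_(i | k.+1%:R / K%:R <= dotp v (y i)) p i <=
    G * Num.sqrt (1 - (k%:R / K%:R) ^+ 2) ^+ m.
  move=> v1 kK; apply: le_trans (hG _ _); last first.
    by rewrite divr_ge0 ?(ltW K0')//= ltr_pdivrMr// mul1r ltr_nat.
  apply: le_trans (hp _ _ v1) _; apply: capfrac_anti.
  have : eta <= K%:R^-1 by rewrite ge_min lexx orbT.
  by rewrite -[k.+1%:R]natr1 mulrDl mul1r => ?; lra.
have mgf v : dotp v v <= 1 ->
    \sum_i p i * expR (t * dotp v (y i)) <= B * expR (t * c).
  move=> v1; apply: le_trans (mgf_le y1 p0 p1 c01 K0 G1 hp' v1) _.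
  by rewrite ler_wpM2r ?expR_ge0.
have t0 : 0 <= t.
  case/andP: c01 => c0 c1; rewrite mulr_ge0// divr_ge0 ?(ltW c0)// subr_ge0.
  by rewrite expr_le1// ltW.
have D0 : 0 <= (1 + eps) * capfrac m a by rewrite mulr_ge0 ?(ltW F0)//; lra.
have hD i : \sum_(j | c ^+ 2 < dotp (y i) (y j)) p j <= (1 + eps) * capfrac m a.
  apply: (@le_trans _ _ (\sum_(j | a <= dotp (y i) (y j)) p j)).
    rewrite c2 [leRHS](bigID (fun j => a < dotp (y i) (y j)))/=.
    rewrite -[leLHS]addr0 lerD ?sumr_ge0// le_eqVlt; apply/orP; left; apply/eqP.
    by apply: eq_bigl => j; case: ltgtP.
  apply: le_trans (hp _ _ (y1 i)) _.
  apply: (@le_trans _ _ (capfrac m (a - eta0))).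
    by apply: capfrac_anti; rewrite lerD2l lerN2 ge_min lexx.
  by rewrite /capfrac mulrA ler_pM2r ?invr_gt0.
have [I Iind hI] := exists_large_code y1 p0 p1 t0 c01 B0 mgf E0 del0 M0 hdel
  D0 hD y00 hy dy.
apply: (le_trans hI); rewrite ler_wpM2r//.
  have db : 0 < 1 - del * (1 + y0) by rewrite subr_gt0.
  have BE0 : 0 <= B * E ^+ 2 by rewrite mulr_ge0 ?(ltW B0)// exprn_ge0// ltW.
  rewrite addr_ge0// mulr_ge0//; last exact: divr_ge0.
  by rewrite divr_ge0 ?expR_ge0 ?(ltW db).
by rewrite ler_nat; apply: (code_of_set y1) => i j iI jI ij; rewrite -c2; apply: Iind.
Qed.

End Asymptotics.

(** Here [m] is one less than the dimension: it is the exponent in the cap volumes. *)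
Lemma max_code_size_asymptotic (R : realType) (theta e' : R) :
  0 < cos theta < 1 -> 0 < e' <= 1 ->
  \forall m \near \oo, forall n, m = n.+1 ->
    (1 - e') * ln (Num.sqrt (1 + cos theta)) * n.+2%:R <=
    (max_code_size n.+2 theta)%:R * capfrac n.+1 (cos theta).
Proof.
move=> cos01 /andP[e'0 e'1]; case/andP: (cos01) => a0 a1.
set a := cos theta in a0 a1 *; set L := ln _.
pose c := Num.sqrt a; pose kap := c / (1 - c ^+ 2).
have c2 : c ^+ 2 = a by rewrite sqr_sqrtr// ltW.
have c0 : 0 < c by rewrite sqrtr_gt0.
have expL : expR L = Num.sqrt (1 + a) by rewrite lnK// posrE sqrtr_gt0 addr_gt0.
have L0 : 0 < L by rewrite ln_gt0// -[ltLHS]sqrtr1 ltr_sqrt; lra.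
have kap0 : 0 < kap by rewrite divr_gt0// c2; lra.
(* All exponential losses are small multiples of [eps * m]; this choice keeps their total within the
   share [e']. *)
pose eps := e' * L / (10 * (L + 1)).
have L1 : 0 < 10 * (L + 1) by lra.
have eps0 : 0 < eps by rewrite divr_gt0// mulr_gt0.
have epsE : 10 * eps * (L + 1) = e' * L.
  by rewrite /eps; field; lra.
have eps1 : 10 * eps <= 1 by nra.
have epsL : 10 * eps <= L by nra.
pose S := Num.sqrt (1 - c ^+ 2).
have S0 : 0 < S by rewrite sqrtr_gt0 c2; lra.
pose e := Num.sqrt (1 - expR (- (eps / 2))).
have ex1 : expR (- (eps / 2)) < 1 by rewrite -[ltRHS]expR0 ltr_expR; lra.
have ex0 := expR_gt0 (- (eps / 2)).
have e0 : 0 < e by rewrite sqrtr_gt0 subr_gt0.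
have e1 : e < 1 by rewrite -[ltRHS]sqrtr1 ltr_sqrt; lra.
have esq : Num.sqrt (1 - e ^+ 2) = expR (- (eps / 4)).
  rewrite sqr_sqrtr ?subr_ge0 ?(ltW ex1)// opprB addrC subrK.
  rewrite (_ : - (eps / 2) = - (eps / 4) + - (eps / 4)); last by field.
  by rewrite expRD -expr2 sqrtr_sqr ger0_norm ?expR_ge0.
(* Makes [2 * kap / K <= eps / 4], the loss due to the layers. *)
pose K := (Num.truncn (8 * kap / eps)).+1.
have hK : 8 * kap / eps <= K%:R.
  by have /andP[_ /ltW] := truncn_itv (divr_ge0 (mulr_ge0 (ler0n R 8) (ltW kap0)) (ltW eps0)).
have K0 : 0 < K%:R :> R by rewrite ltr0n.
(* Makes [eps * M ^ 2 - 2 * kap * M >= eps], so that the Chernoff term of [hdel] is at most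
   [E^-1]. *)
pose M := (Num.truncn (2 * kap / eps)).+2.
have hM : 2 * kap / eps + 1 <= M%:R.
  have /andP[_ /ltW h] := truncn_itv (divr_ge0 (mulr_ge0 (ler0n R 2) (ltW kap0)) (ltW eps0)).
  by rewrite /M -[X in _ <= X]natr1 lerD2r.
have M0 : 0 < M%:R :> R by rewrite ltr0n.
pose b1 := expR (eps / 2) - 1.
have b10 : 0 < b1 by rewrite subr_gt0 -[ltLHS]expR0 ltr_expR; lra.
pose C1 := (a - a / (1 + b1)) / 2.
have C10 : 0 < C1.
  by rewrite divr_gt0// subr_gt0 ltr_pdivrMr; [nra|lra].
(* The activity is [S ^- m * E ^- 3] and the cap area at least [S ^+ m * expR ((L - eps) * m)]:
   their product has rate at least [L - 4 * eps], and one more [eps] makes the error term of the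
   final bound small. *)
pose r := L - 5 * eps.
have r0 : 0 < r by rewrite /r; lra.
near=> m => n mn.
have N1 : K.+1%:R * (2 / e) * (1 + m%:R) <= expR (eps / 2 * m%:R).
  by near: m; apply: exp_dominates; lra.
have N2 : C1^-1 * (1 + m%:R) <= expR (eps / 2 * m%:R).
  by near: m; apply: exp_dominates; lra.
have N3 : 2 * (1 + r) * (1 + m%:R) <= expR (r * m%:R).
  by near: m; apply: exp_dominates.
have N4 : 2 * (1 + m%:R) <= expR (eps * m%:R) by near: m; apply: exp_dominates.
have N5 : 6 * (1 + r) / eps * (1 + m%:R) <= expR (eps / M%:R ^+ 2 * m%:R).
  by near: m; apply: exp_dominates; rewrite divr_gt0// exprn_gt0.
have N6 : eps^-1 * (1 + m%:R) <= expR (eps * m%:R) by near: m; apply: exp_dominates.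
have N7 : 12 / e' <= m%:R by near: m; exact: nbhs_infty_ger.
set x : R := m%:R in N1 N2 N3 N4 N5 N6 N7 *.
have x0 : 0 <= x by rewrite /x.
have drop (C y : R) : 0 <= C -> C * (1 + x) <= y -> C <= y.
  by move=> C0; apply: le_trans; rewrite ler_peMr// lerDl.
have {}N1 := drop _ _ (mulr_ge0 (ler0n _ _) (divr_ge0 (ler0n _ _) (ltW e0))) N1.
have {}N2 : C1^-1 <= expR (eps / 2 * x) by apply: drop N2; rewrite invr_ge0 ltW.
have {}N4 : 2 <= expR (eps * x) by apply: drop N4.
have {}N6 : eps^-1 <= expR (eps * x) by apply: drop N6; rewrite invr_ge0 ltW.
pose y0 := r * x.
have y00 : 0 <= y0 by rewrite mulr_ge0// ltW.
have y0x : 1 + y0 <= (1 + r) * (1 + x) by rewrite /y0; have := r0; have := x0; clear; nra.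
have expm u : expR u ^+ m = expR (u * x) by rewrite -expRM_natl mulrC.
(* The constant [L] arises here, from [Num.sqrt (1 - a ^+ 2) = S * expR L]. *)
have Flow : S ^+ m * expR ((L - eps) * x) <= capfrac m a.
  have := @capfrac_ge R m a b1; rewrite a0 a1 => /(_ isT b10); apply: le_trans.
  rewrite -/C1 (_ : 1 + b1 = expR (eps / 2)); last by rewrite /b1; ring.
  have -> : Num.sqrt (1 - a ^+ 2) = S * expR L.
    rewrite expL /S c2 -sqrtrM; last by rewrite subr_ge0 ltW.
    by congr Num.sqrt; ring.
  rewrite -expRN -mulrA -expRD exprMn expm.
  rewrite [leRHS]mulrCA ler_wpM2l ?exprn_ge0 ?(ltW S0)//.
  rewrite (_ : (L - eps) * x = - (eps / 2 * x) + (L - eps / 2) * x); last by field.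
  rewrite expRD ler_wpM2r ?expR_ge0// expRN.
  by rewrite -[leRHS]invrK lef_pV2 ?posrE ?invr_gt0 ?expR_gt0.
have F0 : 0 < capfrac m a by apply: lt_le_trans Flow; rewrite mulr_gt0 ?exprn_gt0 ?expR_gt0.
pose G := 2 / e * expR (eps / 4 * x).
have G1 : 1 <= G.
  rewrite mulr_ege1//; first by rewrite ler_pdivlMr// mul1r (le_trans (ltW e1))// ler1n.
  by rewrite -[leLHS]expR0 ler_expR mulr_ge0// divr_ge0// ltW.
pose E := expR (eps * x); have E0 : 0 < E by exact: expR_gt0.
pose B := S ^+ m * E.
(* Its power [M ^ 2] is [3 ^+ (M ^ 2) / E], more than the two terms of size [E^-1] in [hdel]. *)
pose del := 3 * expR (- (eps / M%:R ^+ 2 * x)).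
have del0 : 0 <= del by rewrite mulr_ge0 ?expR_ge0.
have hdy : del * (1 + y0) <= eps / 2.
  rewrite /del expRN mulrAC ler_pdivrMr ?expR_gt0//.
  apply: le_trans (ler_wpM2l _ N5); last by rewrite divr_ge0// ltW.
  rewrite (_ : eps / 2 * _ = 3 * ((1 + r) * (1 + x))); last first.
    by field; rewrite gt_eqF.
  by rewrite ler_wpM2l.
have hG z : 0 <= z < 1 -> capfrac m z <= G * Num.sqrt (1 - z ^+ 2) ^+ m.
  move=> z01; have := @capfrac_le R m z e z01; rewrite e0 e1 => /(_ isT) /le_trans; apply.
  rewrite esq expm mulrC /G mulNr expRN.
  rewrite le_eqVlt; apply/orP; left; apply/eqP; congr (_ * _).
  by field; rewrite ?gt_eqF ?expR_gt0.
have hB : K.+1%:R * G * expR (x * kap * (2 / K%:R)) * Num.sqrt (1 - c ^+ 2) ^+ m <= B.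
  rewrite -/S mulrC /B ler_wpM2l ?exprn_ge0 ?(ltW S0)//.
  have h : expR (x * kap * (2 / K%:R)) <= expR (eps / 4 * x).
    rewrite ler_expR (_ : x * kap * (2 / K%:R) = (2 * kap / K%:R) * x); last by ring.
    rewrite ler_wpM2r// ler_pdivrMr//; have := hK; rewrite ler_pdivrMr//; clear; lra.
  have KG0 : 0 <= K.+1%:R * G by rewrite mulr_ge0// (le_trans ler01).
  apply: (le_trans (ler_wpM2l KG0 h)).
  rewrite [leLHS](_ : _ = K.+1%:R * (2 / e) *
    (expR (eps / 4 * x) * expR (eps / 4 * x))); last by rewrite /G; ring.
  rewrite -expRD -mulrDl (_ : eps / 4 + eps / 4 = eps / 2); last by field.
  apply: (le_trans (ler_wpM2r (expR_ge0 _) N1)).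
  by rewrite -expRD -mulrDl /E (_ : eps / 2 + eps / 2 = eps)//; field.
have hdel : E^-1 + expR (2 * (x * kap) * M%:R) / E ^+ (M ^ 2) < del ^+ (M ^ 2).
  have h1 : expR (2 * (x * kap) * M%:R) / E ^+ (M ^ 2) <= E^-1.
    rewrite /E -expRM_natl -!expRN -expRD ler_expR natrX.
    have h : 0 <= M%:R * (eps * M%:R - 2 * kap) - eps.
      have : 2 * kap + eps <= M%:R * eps.
        have := ler_wpM2r (ltW eps0) hM; rewrite mulrDl mul1r divfK// gt_eqF//.
      have : 1 <= M%:R :> R by rewrite ler1n.
      by have := eps0; have := kap0; clear; nra.
    by have := mulr_ge0 h x0; clear; lra.
  have -> : del ^+ (M ^ 2) = 3 ^+ (M ^ 2) * E^-1.
    rewrite exprMn -expRM_natl natrX -expRN; congr (_ * expR _).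
    by field; rewrite gt_eqF.
  apply: (@lt_le_trans _ _ (3 * E^-1)).
    apply: (@le_lt_trans _ _ (E^-1 + E^-1)); first by rewrite lerD2l.
    by rewrite -[ltLHS]mulr2n -[ltLHS]mulr_natl ltr_pM2r ?invr_gt0// ltr_nat.
  rewrite ler_wpM2r ?invr_ge0 ?(ltW E0)//.
  by rewrite -[leLHS]expr1 ler_weXn2l ?ler1n ?expn_gt0.
have hy : expR (- y0) * (1 + y0) <= expR (- E^-1).
  apply: (@le_trans _ _ (1 / 2)).
    rewrite expRN mulrC ler_pdivrMr ?expR_gt0// /y0.
    apply: (le_trans y0x); have := N3; clear; lra.
  apply: le_trans (expR_ge1Dx _).
  have : E^-1 <= 2^-1 by rewrite lef_pV2 ?posrE.
  by clear; lra.
have dy1 : del * (1 + y0) < 1 by have := hdy; have := eps1; have := eps0; clear; lra.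
subst m.
have := @max_code_size_finite_bound R theta cos01 n K M G B E del y0 eps isT G1 eps0 F0 hG hB
  E0 del0 isT hdel y00 hy dy1.
set Amax := (max_code_size n.+2 theta)%:R; set F := capfrac n.+1 a in Flow F0 *.
have A0 : 0 <= Amax by exact: ler0n.
have BE0 : 0 < B * E ^+ 2 by rewrite !mulr_gt0 ?exprn_gt0.
move=> main.
have {}main : 1 + y0 <= Amax * (B * E ^+ 2 * expR y0 + (1 + eps) * F / (1 - del * (1 + y0))).
  have := ler_wpM2r (ltW (mulr_gt0 BE0 (expR_gt0 y0))) main.
  have du : 1 - del * (1 + y0) != 0 by rewrite gt_eqF// subr_gt0.
  have ey : expR y0 != 0 by rewrite gt_eqF ?expR_gt0.
  have BEn : B * E ^+ 2 != 0 by rewrite gt_eqF.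
  rewrite expRN [X in X <= _ -> _](_ : _ = 1 + y0); last first.
    by move: BEn; set BE := B * _ => BEn; field; rewrite BEn ey.
  move=> /le_trans; apply; rewrite le_eqVlt; apply/orP; left; apply/eqP.
  by move: BEn du; set BE := B * _; set dd := del * _ => BEn du; field; rewrite BEn ey du.
have small : B * E ^+ 2 * expR y0 <= eps * F.
  rewrite (_ : B * E ^+ 2 * expR y0 = E^-1 * (S ^+ n.+1 * expR ((L - eps) * x))); last first.
    have -> : expR ((L - eps) * x) = expR y0 * E ^+ 4.
      by rewrite /E -expRM_natl -expRD; congr expR; rewrite /y0 /r; ring.
    by rewrite /B; field; rewrite gt_eqF.
  apply: ler_pM => //.
  - by rewrite invr_ge0 ltW.
  - by rewrite mulr_ge0 ?expR_ge0// exprn_ge0// ltW.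
  - by rewrite -[leRHS]invrK lef_pV2 ?posrE ?invr_gt0.
have inv1 : (1 + eps) * F / (1 - del * (1 + y0)) <= (1 + eps) * F * (1 + eps).
  rewrite ler_pdivrMr ?subr_gt0// -[leRHS]mulrA; apply: ler_peMr.
    by rewrite mulr_ge0 ?(ltW F0)// addr_ge0// ltW.
  by have := hdy; have := eps1; have := eps0; clear; nra.
have {}main : y0 <= Amax * F * (1 + 4 * eps).
  apply: (@le_trans _ _ (1 + y0)); first by rewrite lerDr.
  apply: (le_trans main); rewrite -[leRHS]mulrA; apply: ler_wpM2l => //.
  apply: (le_trans (lerD small inv1)).
  have h : F * (eps * eps) <= F * eps.
    rewrite ler_wpM2l ?(ltW F0)// ler_piMr ?(ltW eps0)//.
    by have := eps1; have := eps0; clear; lra.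
  by have := h; clear; lra.
have xe : 12 <= x * e' by have := N7; rewrite ler_pdivrMr.
(* The dimension is [x + 1]; [xe] pays for the extra 1. *)
rewrite -[n.+2%:R]natr1 -/x.
exact: (asymptotic_arith L0 e'0 e'1 eps0 eps1 epsE xe main).
Unshelve. all: by end_near. Qed.

(** * Trigonometric form of the constant and conclusion *)

Lemma cos_acute (R : realType) (theta : R) : 0 < theta -> theta < pi / 2 ->
  0 < cos theta < 1.
Proof.
move=> t0 t1; have p0 : 0 < pi :> R by exact: pi_gt0.
rewrite cos_gt0_pihalf ?t1 ?andbT; last by lra.
by rewrite -cos0 ltr_cos// in_itv/=; lra.
Qed.

(** By the half-angle formulas both sides equal [Num.sqrt 2 * cos (theta / 2)]. *)
Lemma sin_ratio (R : realType) (theta : R) : 0 < theta -> theta < pi / 2 ->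
  sin theta / (Num.sqrt 2 * sin (theta / 2)) = Num.sqrt (1 + cos theta).
Proof.
move=> t0 t1; have p0 : 0 < pi :> R by exact: pi_gt0.
have s0 : 0 < sin (theta / 2) by apply: sin_gt0_pi; lra.
have c0 : 0 < cos (theta / 2) by apply: cos_gt0_pihalf; lra.
have tE : theta = (theta / 2) *+ 2 by rewrite mulr2n; field.
have s20 : 0 < Num.sqrt 2 :> R by rewrite sqrtr_gt0.
have s22 : Num.sqrt 2 * Num.sqrt 2 = 2 :> R by rewrite -expr2 sqr_sqrtr.
have -> : 1 + cos theta = 2 * cos (theta / 2) ^+ 2.
  by rewrite [in LHS]tE cos_mulr2n mulr2n; ring.
rewrite [in sin theta]tE sin_mulr2n sqrtrM// sqrtr_sqr gtr0_norm//.
rewrite (_ : (_ * sin _) *+ 2 = (Num.sqrt 2 * Num.sqrt 2) * (cos (theta / 2) * sin (theta / 2))).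
  by field; rewrite !gt_eqF.
by rewrite s22 mulr_natl.
Qed.

Lemma capfrac_gt0 (R : realType) n (a : R) : 0 < a < 1 -> 0 < capfrac n a.
Proof.
move=> a01; apply: lt_le_trans (capfrac_ge n a01 ltr01).
case/andP: a01 => a0 a1.
rewrite mulr_gt0 ?exprn_gt0 ?divr_gt0 ?sqrtr_gt0 ?subr_gt0 ?expr_lt1 ?(ltW a0)//.
by rewrite ltr_pdivrMr//; lra.
Qed.

Theorem theorem2 (R : realType) (theta : R) (theta_gt0 : 0 < theta)
    (theta_lt : theta < pi / 2) :
  exists o : nat -> R,
    o @ \oo --> (0 : R) /\
    \forall d \near \oo, forall x : 'rV[R]_d, sphere R d x ->
      (1 + o d) * ln (sin theta / (Num.sqrt 2 * sin (theta / 2)))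
        * d%:R * (surface_measure (cap theta x))^-1
      <= (max_code_size d theta)%:R.
Proof.
have cos01 := cos_acute theta_gt0 theta_lt.
rewrite sin_ratio//; set L := ln _.
have L0 : 0 < L.
  by rewrite ln_gt0// -[ltLHS]sqrtr1 ltr_sqrt; case/andP: cos01 => ? ?; lra.
pose ratio d : R := (max_code_size d theta)%:R * capfrac d.-1 (cos theta) / (L * d%:R).
(* With the relative error cut off at 0, the inequality holds by construction and convergence needs
   only a lower bound on [ratio]. *)
exists (fun d => Num.min 0 (ratio d - 1)); split.
  apply/cvgrPdist_le => eps eps0.
  have e01 : 0 < Num.min eps 1 <= 1 by rewrite lt_min eps0 ltr01 ge_min lexx orbT.
  have [N _ hN] := max_code_size_asymptotic cos01 e01.
  (* Dimensions 0 and 1 are discarded, since [capfrac] describes caps from dimension 2 on. *)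
  exists N.+2 => // -[|[|n]]//= Nn.
  rewrite sub0r normrN ler0_norm ?ge_min ?lexx// oppr_min oppr0 ge_max (ltW eps0)/=.
  have := hN n.+1 _ n erefl; rewrite -/L /= => /(_ (ltnW Nn)) h.
  have Ld : 0 < L * n.+2%:R by rewrite mulr_gt0.
  rewrite -mulrA -ler_pdivlMr// in h.
  have mineps : Num.min eps 1 <= eps by rewrite ge_min lexx.
  rewrite /ratio/= opprB lerBlDr addrC -lerBlDr.
  by apply: le_trans h; rewrite lerD2l lerN2.
exists 2%N => // -[|[|n]]//= _ x xS.
rewrite (surface_measure_cap _ xS); set F := capfrac _ _.
have F0 : 0 < F by exact: capfrac_gt0.
have Ld : 0 < L * n.+2%:R by rewrite mulr_gt0.
rewrite -[_ * L * _]mulrA ler_pdivrMr// -ler_pdivlMr//.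
by rewrite -lerBrDl ge_min lexx orbT.
Qed.
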